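(* Let $n\geqslant 2$ and let $M=(\alpha_{i,j})_{1\leqslant i,j\leqslant 2}$ be a Griffiths positive $2\times 2$ matrix of constant coefficient $(1,1)$-forms on $\mathbb{C}^n$ with only diagonalized entries. Let $\Omega=\det(M)$. Then: (1) if $n\leqslant 5$, then for every Kähler form $\omega$, $\Omega$ satisfies HLT, HRR and LD (with respect to $\omega$) for all bidegrees $(p,q)$ with $p,q\geqslant0$, $p+q=n-2$; (2) if $n\geqslant 6$, then $\Omega$ satisfies HLT for the bidegrees $(n-2,0)$, $(n-3,1)$, $(1,n-3)$ and $(0,n-2)$.
   Context: Let $V=(\mathbb{C}^n)^*$ and $V^{p,q}=\Lambda^pV\otimes\Lambda^q\overline{V}$ be the space of constant coefficient $(p,q)$-forms on $\mathbb{C}^n$ (zero unless $0\leqslant p,q\leqslant n$). A form in $V^{1,1}$ is Kähler if it equals $\sum_{l}\frac{\sqrt{-1}}{2}dw_l\wedge d\overline{w_l}$ in some complex linear coordinates $(w_l)$. A $k\times k$ matrix $M=(\alpha_{i,j})$ of elements of $V^{1,1}$ with $\alpha_{i,j}=\overline{\alpha_{j,i}}$ is Griffiths positive if $\sum_{i,j}\theta_i\alpha_{i,j}\overline{\theta_j}$ is Kähler for all $\theta\in\mathbb{C}^k\setminus\{0\}$. $M$ has diagonalized entries if there are complex linear coordinates $(z_1,\dots,z_n)$ with $\alpha_{i,j}=\sum_{l=1}^n b_{i,j}^{(l)}\frac{\sqrt{-1}}{2}dz_l\wedge d\overline{z_l}$ for all $i,j$ (no terms $dz_u\wedge d\overline{z_v}$,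 $u\neq v$). $\det(M)=\sum_{\sigma\in S_k}\mathrm{sgn}(\sigma)\alpha_{1,\sigma(1)}\wedge\dots\wedge\alpha_{k,\sigma(k)}\in V^{k,k}$. For a Kähler form $\omega$, define $\star:V^{n,n}\to\mathbb{C}$ by $\eta=\star(\eta)\,\omega^n/n!$. For $\Omega\in V^{k,k}$ and $p+q=n-k$: HLT for $(p,q)$ means $\alpha\mapsto\alpha\wedge\Omega$ is an isomorphism $V^{p,q}\to V^{n-q,n-p}$; with $Q(\alpha,\beta)=(\sqrt{-1})^{p-q}(-1)^{\frac{(p+q)(p+q-1)}{2}}\star(\alpha\wedge\overline{\beta}\wedge\Omega)$ and $P^{p,q}=\{\alpha\in V^{p,q}:\alpha\wedge\Omega\wedge\omega=0\}$, HRR means $Q$ is positive definite on $P^{p,q}$, and LD means $V^{p,q}=(\omega\wedge V^{p-1,q-1})\oplus P^{p,q}$ with the summands $Q$-orthogonal. *)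

(* Defs.v *)
(* complex numbers C := R[i] (mathcomp-real-closed) over a
   real-number structure R : realType (mathcomp-reals). *)
From HB Require Import structures.
From mathcomp Require Import all_boot all_order all_algebra all_fingroup.
From mathcomp Require Import reals complex.
Set Implicit Arguments. Unset Strict Implicit. Unset Printing Implicit Defensive.
Import Order.TTheory GRing.Theory Num.Theory.
Local Open Scope ring_scope.

Section Forms.
Variables (R : realType) (n : nat).
Local Notation C := R[i].

(* Constant coefficient forms on C^n: the exterior algebra on the 2n
   generators dz_0..dz_{n-1} (indices lshift n k) and
   dzbar_0..dzbar_{n-1} (indices rshift n k) of 'I_(n+n).  A cform is its
   family of coefficients on the basis e_K = wedge of the generators in K,
   taken in increasing order of indices. *)
Definition cform := {ffun {set 'I_(n + n)} -> C}.

(* sign of the shuffle putting (e_I, e_J) into increasing order *)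
Definition shuffle_sign (I J : {set 'I_(n + n)}) : C :=
  (-1) ^+ #|[set ij in setX I J | (ij.2 < ij.1)%N]|.

Definition wedge (a b : cform) : cform :=
  [ffun K : {set 'I_(n + n)} => \sum_(I : {set 'I_(n + n)} | I \subset K)
      shuffle_sign I (K :\: I) * a I * b (K :\: I)].

(* the unit 1 of the exterior algebra and powers *)
Definition form1 : cform := [ffun K : {set 'I_(n + n)} => (K == set0)%:R].
Definition wpow (w : cform) (k : nat) : cform := iter k (wedge w) form1.

Definition holo_idx : {set 'I_(n + n)} := [set lshift n k | k : 'I_n].
Definition anti_idx : {set 'I_(n + n)} := [set rshift n k | k : 'I_n].

(* a is of pure bidegree (p,q), i.e. a \in V^{p,q} *)
Definition is_pq (p q : nat) (a : cform) : Prop :=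
  forall K, a K != 0 -> #|K :&: holo_idx| = p /\ #|K :&: anti_idx| = q.

(* dz_k and dzbar_k *)
Definition dz (k : 'I_n) : cform := [ffun K : {set 'I_(n + n)} => (K == [set lshift n k])%:R].
Definition dzb (k : 'I_n) : cform := [ffun K : {set 'I_(n + n)} => (K == [set rshift n k])%:R].

(* exchange dz_k <-> dzbar_k *)
Definition swap_idx (i : 'I_(n + n)) : 'I_(n + n) :=
  match split i with inl k => rshift n k | inr k => lshift n k end.

(* complex conjugation of forms: conj(dz_I /\ dzbar_J) = dzbar_I /\ dz_J
   = (-1)^(|I||J|) dz_J /\ dzbar_I *)
Definition fconj (a : cform) : cform :=
  [ffun K : {set 'I_(n + n)} => (-1) ^+ (#|K :&: holo_idx| * #|K :&: anti_idx|)
              * (a (swap_idx @: K))^*].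

(* dw_l for linear coordinates w = A z *)
Definition dw (A : 'M[C]_n) (l : 'I_n) : cform := \sum_k A l k *: dz k.

Definition kahler_std (A : 'M[C]_n) (l : 'I_n) : cform :=
  ('i / 2) *: wedge (dw A l) (fconj (dw A l)).

(* Kähler: sum_l (i/2) dw_l /\ dw_l-bar in some complex linear coordinates *)
Definition kahler (w : cform) : Prop :=
  exists A : 'M[C]_n, A \in unitmx /\ w = \sum_l kahler_std A l.

(* k x k Hermitian matrices of (1,1)-forms, Griffiths positivity *)
Definition griffiths_positive (k : nat) (M : 'I_k -> 'I_k -> cform) : Prop :=
  (forall i j, is_pq 1 1 (M i j)) /\
  (forall i j, M i j = fconj (M j i)) /\
  (forall theta : 'I_k -> C, (exists i, theta i != 0) ->
     kahler (\sum_i \sum_j (theta i * (theta j)^*) *: M i j)).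

Definition diagonalized_entries (k : nat) (M : 'I_k -> 'I_k -> cform) : Prop :=
  exists A : 'M[C]_n, A \in unitmx /\
  exists b : 'I_k -> 'I_k -> 'I_n -> C,
    forall i j, M i j = \sum_l b i j l *: kahler_std A l.

(* det(M) = sum_sigma sgn(sigma) M_{1,s1} /\ ... /\ M_{k,sk} *)
Definition form_det (k : nat) (M : 'I_k -> 'I_k -> cform) : cform :=
  \sum_(s : 'S_k) (-1) ^+ s *:
     foldr wedge form1 [seq M i (s i) | i <- enum 'I_k].

(* star : V^{n,n} -> C,  eta = star(eta) w^n/n! *)
Definition star (w : cform) (eta : cform) : C :=
  eta setT / ((wpow w n) setT / (n`!)%:R).

(* Hard Lefschetz: alpha |-> alpha /\ Omega is an isomorphism
   V^{p,q} -> V^{n-q,n-p} *)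
Definition HLT (Om : cform) (p q : nat) : Prop :=
  (forall a, is_pq p q a -> wedge a Om = 0 -> a = 0) /\
  (forall b, is_pq (n - q) (n - p) b ->
     exists a, is_pq p q a /\ wedge a Om = b).

Definition Qform (w Om : cform) (p q : nat) (a b : cform) : C :=
  'i ^ (p%:Z - q%:Z) * (-1) ^+ ((p + q) * (p + q).-1)./2
  * star w (wedge (wedge a (fconj b)) Om).

Definition primitive (w Om : cform) (p q : nat) (a : cform) : Prop :=
  is_pq p q a /\ wedge (wedge a Om) w = 0.

Definition HRR (w Om : cform) (p q : nat) : Prop :=
  forall a, primitive w Om p q a -> a != 0 -> 0 < Qform w Om p q a a.

(* V^{p-1,q-1}, which is 0 when p = 0 or q = 0 *)
Definition in_lower (p q : nat) (b : cform) : Prop :=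
  if (p == 0%N) || (q == 0%N) then b = 0 else is_pq p.-1 q.-1 b.

(* Lefschetz decomposition V^{p,q} = w /\ V^{p-1,q-1} (+) P^{p,q},
   direct and Q-orthogonal *)
Definition LD (w Om : cform) (p q : nat) : Prop :=
  (forall a, is_pq p q a ->
     exists b c, in_lower p q b /\ primitive w Om p q c /\ a = wedge w b + c) /\
  (forall b, in_lower p q b -> primitive w Om p q (wedge w b) -> wedge w b = 0) /\
  (forall b c, in_lower p q b -> primitive w Om p q c ->
     Qform w Om p q (wedge w b) c = 0 /\ Qform w Om p q c (wedge w b) = 0).

End Forms.

(* Main.v *)
(** In the coordinates [z] that diagonalize [M], [Om] equals
    [1/2 * sum_{r,s} c_rs om_r om_s], where [om_l = (i/2) dz_l dzbar_l] and
    [c_rs > 0] is the mixed discriminant of the positive definite 2x2 matrices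
    [B^r], [B^s] of coefficients of [M].  Write
    [Q(h,k) = Qform w Om p q h k] with [p+q = n-2] and [min(p,q) <= 1].

    (a) [Q] is negative definite on [w V^{p-1,q-1}]: up to its sign,
    [Q(w b, w b)] is a positive combination of squared coefficients of the top
    forms [b dw_l dw_m dz_r dz_s].

    (b) [Q] is block diagonal in the monomials [dz_A dzbar_B om_S]
    ([A], [B], [S] disjoint), one block for each [(A,B)].  A block with
    [S = 0] is one positive number.  A block with [|S| = 1] is indexed by the
    four-element complement [L] of [A u B], with matrix
    [- c_{L minus {l,m}}] off the diagonal and [0] on it.  Rescaling the
    variables by [prod_{j <> l} c_lj] turns it into a positive multiple of
    [- c_lm], and
    [sum_{l <> m} c_lm z_l zbar_m = |tr H|^2 - |H|^2 - 2 sum_l det(B^l) |z_l|^2]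
    with [H = sum_l z_l B^l].  Hence the block is positive definite on the
    hyperplane [tr H = 0], and these conditions are the kernel of a linear map
    [Phi : V^{p,q} -> V^{p-1,q-1}].

    (c) By (a) and (b), [b |-> Phi (w b)] is injective, so bijective.
    If [a] is primitive, then [a = w b + h] with [Phi h = 0], and
    [Q(a,a) = Q(h,h) - Q(w b, w b) > 0] unless [a = 0].  This is HRR, and
    HLT and LD follow from it and from (a) by counting dimensions. *)
Require Import Defs.
From HB Require Import structures.
From mathcomp Require Import all_boot all_order all_algebra all_fingroup.
From mathcomp Require Import reals complex.
From mathcomp Require Import zify ring.
Import Order.TTheory GRing.Theory Num.Theory.
Local Open Scope ring_scope.

(** The definitions of [Defs] over an arbitrary [numClosedFieldType]: over
    [R[i]] unification unfolds complex arithmetic and does not scale.  The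
    regular module [C^o] makes forms an [lmodType C]; at [C := R[i]] every
    definition below is convertible to its counterpart in [Defs]. *)
Module NumClosed.
Set Implicit Arguments. Unset Strict Implicit. Unset Printing Implicit Defensive.

Section Forms.
Variables (C : numClosedFieldType) (n : nat).
Definition cform := {ffun {set 'I_(n + n)} -> C^o}.

Definition shuffle_sign (I J : {set 'I_(n + n)}) : C :=
  (-1) ^+ #|[set ij in setX I J | (ij.2 < ij.1)%N]|.

Definition wedge (a b : cform) : cform :=
  [ffun K : {set 'I_(n + n)} => \sum_(I : {set 'I_(n + n)} | I \subset K)
      shuffle_sign I (K :\: I) * a I * b (K :\: I)].

Definition form1 : cform := [ffun K : {set 'I_(n + n)} => (K == set0)%:R].
Definition wpow (w : cform) (k : nat) : cform := iter k (wedge w) form1.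

Definition holo_idx : {set 'I_(n + n)} := [set lshift n k | k : 'I_n].
Definition anti_idx : {set 'I_(n + n)} := [set rshift n k | k : 'I_n].

Definition is_pq (p q : nat) (a : cform) : Prop :=
  forall K, a K != 0 -> #|K :&: holo_idx| = p /\ #|K :&: anti_idx| = q.

Definition dz (k : 'I_n) : cform := [ffun K : {set 'I_(n + n)} => (K == [set lshift n k])%:R].

Definition swap_idx (i : 'I_(n + n)) : 'I_(n + n) :=
  match split i with inl k => rshift n k | inr k => lshift n k end.

Definition fconj (a : cform) : cform :=
  [ffun K : {set 'I_(n + n)} => (-1) ^+ (#|K :&: holo_idx| * #|K :&: anti_idx|)
              * (a (swap_idx @: K))^*].

Definition dw (A : 'M[C]_n) (l : 'I_n) : cform := \sum_k A l k *: dz k.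

Definition kahler_std (A : 'M[C]_n) (l : 'I_n) : cform :=
  ('i / 2) *: wedge (dw A l) (fconj (dw A l)).

Definition kahler (w : cform) : Prop :=
  exists A : 'M[C]_n, A \in unitmx /\ w = \sum_l kahler_std A l.

Definition griffiths_positive (k : nat) (M : 'I_k -> 'I_k -> cform) : Prop :=
  (forall i j, is_pq 1 1 (M i j)) /\
  (forall i j, M i j = fconj (M j i)) /\
  (forall theta : 'I_k -> C, (exists i, theta i != 0) ->
     kahler (\sum_i \sum_j (theta i * (theta j)^*) *: M i j)).

Definition diagonalized_entries (k : nat) (M : 'I_k -> 'I_k -> cform) : Prop :=
  exists A : 'M[C]_n, A \in unitmx /\
  exists b : 'I_k -> 'I_k -> 'I_n -> C,
    forall i j, M i j = \sum_l b i j l *: kahler_std A l.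

Definition form_det (k : nat) (M : 'I_k -> 'I_k -> cform) : cform :=
  \sum_(s : 'S_k) (-1) ^+ s *:
     foldr wedge form1 [seq M i (s i) | i <- enum 'I_k].

Definition star (w : cform) (eta : cform) : C :=
  eta setT / ((wpow w n) setT / (n`!)%:R).

Definition HLT (Om : cform) (p q : nat) : Prop :=
  (forall a, is_pq p q a -> wedge a Om = 0 -> a = 0) /\
  (forall b, is_pq (n - q) (n - p) b ->
     exists a, is_pq p q a /\ wedge a Om = b).

Definition Qform (w Om : cform) (p q : nat) (a b : cform) : C :=
  'i ^ (p%:Z - q%:Z) * (-1) ^+ ((p + q) * (p + q).-1)./2
  * star w (wedge (wedge a (fconj b)) Om).

Definition primitive (w Om : cform) (p q : nat) (a : cform) : Prop :=
  is_pq p q a /\ wedge (wedge a Om) w = 0.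

Definition HRR (w Om : cform) (p q : nat) : Prop :=
  forall a, primitive w Om p q a -> a != 0 -> 0 < Qform w Om p q a a.

Definition in_lower (p q : nat) (b : cform) : Prop :=
  if (p == 0%N) || (q == 0%N) then b = 0 else is_pq p.-1 q.-1 b.

Definition LD (w Om : cform) (p q : nat) : Prop :=
  (forall a, is_pq p q a ->
     exists b c, in_lower p q b /\ primitive w Om p q c /\ a = wedge w b + c) /\
  (forall b, in_lower p q b -> primitive w Om p q (wedge w b) -> wedge w b = 0) /\
  (forall b c, in_lower p q b -> primitive w Om p q c ->
     Qform w Om p q (wedge w b) c = 0 /\ Qform w Om p q c (wedge w b) = 0).

End Forms.

Local Notation "a '\w' b" := (wedge a b) (at level 40, left associativity).

(** * The exterior algebra: bilinearity, associativity, graded commutativity *)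

Section Wedge.
Variables (C : numClosedFieldType) (n : nat).
Local Notation form := (cform C n).
Implicit Types (a b c : form) (I J K L : {set 'I_(n + n)}).

Lemma cfD a b K : (a + b) K = a K + b K. Proof. by rewrite ffunE. Qed.
Lemma cfZ (x : C) a K : (x *: a) K = x * a K. Proof. by rewrite ffunE. Qed.
Lemma cf0 K : (0 : form) K = 0. Proof. by rewrite ffunE. Qed.
Lemma cf_sum (T : Type) (r : seq T) (P : pred T) (F : T -> form) K :
  (\sum_(t <- r | P t) F t) K = \sum_(t <- r | P t) F t K.
Proof. exact: sum_ffunE. Qed.

(** Right multiplication under its own name, so that it can carry a linear structure. *)
Definition wedger b a : form := a \w b.

Fact wedge_linear a : linear (wedge a).
Proof.
move=> x b c; apply/ffunP=> K; rewrite cfD cfZ !ffunE mulr_sumr -big_split /=.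
apply: eq_bigr => I _; rewrite cfD cfZ; ring.
Qed.
HB.instance Definition _ a := GRing.isLinear.Build C form form *:%R (wedge a) (wedge_linear a).

Fact wedger_linear b : linear (wedger b).
Proof.
move=> x a c; apply/ffunP=> K; rewrite cfD cfZ !ffunE mulr_sumr -big_split /=.
apply: eq_bigr => I _; rewrite cfD cfZ; ring.
Qed.
HB.instance Definition _ b := GRing.isLinear.Build C form form *:%R (wedger b) (wedger_linear b).

Lemma wedgeBl a b c : (a - b) \w c = a \w c - b \w c. Proof. exact: (linearB (wedger c)). Qed.
Lemma wedgeBr a b c : c \w (a - b) = c \w a - c \w b. Proof. exact: linearB. Qed.
Lemma wedgeZl x a c : (x *: a) \w c = x *: (a \w c). Proof. exact: (linearZZ (wedger c)). Qed.
Lemma wedgeZr x a c : c \w (x *: a) = x *: (c \w a). Proof. exact: linearZZ. Qed.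
Lemma wedge0l c : 0 \w c = 0. Proof. exact: (linear0 (wedger c)). Qed.
Lemma wedge0r c : c \w 0 = 0. Proof. exact: linear0. Qed.
Lemma wedge_suml (T : Type) (r : seq T) (P : pred T) (F : T -> form) c :
  (\sum_(t <- r | P t) F t) \w c = \sum_(t <- r | P t) F t \w c.
Proof. exact: (linear_sum (wedger c)). Qed.
Lemma wedge_sumr (T : Type) (r : seq T) (P : pred T) (F : T -> form) c :
  c \w (\sum_(t <- r | P t) F t) = \sum_(t <- r | P t) c \w F t.
Proof. exact: linear_sum. Qed.

Definition bas K : form := [ffun L => (L == K)%:R].

Lemma basE K L : bas K L = (L == K)%:R. Proof. by rewrite ffunE. Qed.

Lemma cform_basis a : a = \sum_K a K *: bas K.
Proof.
apply/ffunP=> L; rewrite cf_sum (bigD1 L) //= cfZ basE eqxx mulr1 big1 ?addr0 //.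
by move=> K neKL; rewrite cfZ basE eq_sym (negPf neKL) mulr0.
Qed.

(** Used in one factor at a time, this reduces multilinear identities such as associativity to basis
    elements. *)
Lemma lin_ext (f g : {linear form -> form}) :
  (forall K, f (bas K) = g (bas K)) -> f =1 g.
Proof.
move=> fg a; rewrite [a]cform_basis !linear_sum; apply: eq_bigr => K _.
by rewrite !linearZZ fg.
Qed.

Lemma shuffle_prod I J : shuffle_sign C I J = \prod_(i in I) \prod_(j in J) (-1) ^+ (j < i)%N.
Proof.
rewrite pair_big_dep /= /shuffle_sign prodrXr; congr (_ ^+ _).
rewrite -sum1_card big_mkcond [RHS]big_mkcond; apply: eq_bigr => -[i j] _.
by rewrite !inE /=; case: (i \in I) => //=; case: (j \in J) => //=; case: ltnP.
Qed.

Lemma shuffleUl I J K : [disjoint I & J] ->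
  shuffle_sign C (I :|: J) K = shuffle_sign C I K * shuffle_sign C J K.
Proof.
move=> dIJ; rewrite !shuffle_prod -bigU //; by apply: eq_bigl => i; rewrite !inE.
Qed.

Lemma shuffleUr I J K : [disjoint J & K] ->
  shuffle_sign C I (J :|: K) = shuffle_sign C I J * shuffle_sign C I K.
Proof.
move=> dJK; rewrite !shuffle_prod -big_split /=; apply: eq_bigr => i _.
by rewrite -bigU //; apply: eq_bigl => j; rewrite !inE.
Qed.

Lemma shuffle0l K : shuffle_sign C set0 K = 1.
Proof. by rewrite shuffle_prod big_set0. Qed.

Lemma shuffle0r K : shuffle_sign C K set0 = 1.
Proof. by rewrite shuffle_prod big1 // => i _; rewrite big_set0. Qed.

(** Two distinct indices are inverted in exactly one of the two orders, so each pair contributes one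
    factor [-1]. *)
Lemma shuffle_swap I J : [disjoint I & J] ->
  shuffle_sign C I J = (-1) ^+ (#|I| * #|J|) * shuffle_sign C J I.
Proof.
move=> dIJ; have -> : (-1) ^+ (#|I| * #|J|) = \prod_(i in I) \prod_(j in J) (-1) :> C.
  under eq_bigr do rewrite prodr_const.
  by rewrite prodr_const -exprM mulnC.
rewrite !shuffle_prod [X in _ = _ * X]exchange_big -big_split; apply: eq_bigr => i iI.
rewrite -big_split; apply: eq_bigr => j jJ /=.
have: i != j by apply: contraTneq iI => ->; rewrite (disjointFl dIJ).
by rewrite -val_eqE /=; case: ltngtP => //= _ _; rewrite ?expr1 ?expr0 ?mulr1 ?mulN1r ?opprK.
Qed.

Lemma wedge_bas I J :
  bas I \w bas J = if [disjoint I & J] then shuffle_sign C I J *: bas (I :|: J) else 0.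
Proof.
apply/ffunP=> K; rewrite !ffunE.
have -> : (if [disjoint I & J] then shuffle_sign C I J *: bas (I :|: J) else 0) K =
   if [disjoint I & J] && (K == I :|: J) then shuffle_sign C I J else 0.
  by case: ifP; rewrite ?cf0 // cfZ basE; case: eqP; rewrite ?mulr1 ?mulr0.
rewrite big_mkcond (bigD1 I) //= big1 ?addr0; last first.
  by move=> L /negPf nLI; case: ifP => // _; rewrite !basE nLI mulr0 mul0r.
rewrite !basE eqxx mulr1.
case: ifP => sIK; last first.
  by case: ifP => // /andP[_ /eqP eK]; rewrite eK subsetUl in sIK.
case: (K :\: I =P J) => [<-|neJ].
  have -> : I :|: K :\: I = K.
    by apply/setP=> i; rewrite !inE; case: (boolP (i \in I)) => //= /(subsetP sIK) ->.
  have -> : [disjoint I & K :\: I].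
    by rewrite -setI_eq0; apply/eqP/setP => i; rewrite !inE; case: (i \in I).
  by rewrite eqxx mulr1.
rewrite mulr0; case: ifP => // /andP[dIJ /eqP eK].
case: neJ; rewrite eK setDUl setDv set0U; apply/setDidPl.
by rewrite disjoint_sym.
Qed.

Lemma form1E : form1 C n = bas set0. Proof. by []. Qed.

Lemma wedge_bas_assoc I J K : bas I \w (bas J \w bas K) = (bas I \w bas J) \w bas K.
Proof.
rewrite !wedge_bas; have [dJK|ndJK] := boolP [disjoint J & K]; last first.
  rewrite wedge0r; case: ifP => [dIJ|_]; last by rewrite wedge0l.
  by rewrite wedgeZl wedge_bas -!setI_eq0 setIUl setU_eq0 !setI_eq0 (negPf ndJK) andbF scaler0.
rewrite wedgeZr wedge_bas; have [dIJ|ndIJ] := boolP [disjoint I & J]; last first.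
  by rewrite wedge0l -!setI_eq0 setIUr setU_eq0 !setI_eq0 (negPf ndIJ) /= scaler0.
rewrite wedgeZl wedge_bas -![[disjoint _ & _ :|: _]]setI_eq0 -![[disjoint _ :|: _ & _]]setI_eq0.
rewrite setIUl setIUr !setU_eq0 !setI_eq0 dIJ dJK /= andbT.
case: ifP => [dIK|]; last by rewrite !scaler0.
by rewrite !scalerA setUA shuffleUl // shuffleUr // mulrC mulrA.
Qed.

Lemma wedgeA a b c : a \w (b \w c) = (a \w b) \w c.
Proof.
apply: (@lin_ext (wedge a \o wedge b) (wedge (a \w b))) => K /=.
apply: (@lin_ext (wedge a \o wedger (bas K)) (wedger (bas K) \o wedge a)) => J /=.
apply: (@lin_ext (wedger (bas J \w bas K)) (wedger (bas K) \o wedger (bas J))) => I /=.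
exact: wedge_bas_assoc.
Qed.

Lemma wedge1l a : form1 C n \w a = a.
Proof.
apply: (@lin_ext (wedge (form1 C n)) idfun) => K /=.
by rewrite form1E wedge_bas -setI_eq0 set0I eqxx shuffle0l set0U scale1r.
Qed.

Lemma wedge1r a : a \w form1 C n = a.
Proof.
apply: (@lin_ext (wedger (form1 C n)) idfun) => K /=; rewrite /wedger.
by rewrite form1E wedge_bas -setI_eq0 setI0 eqxx shuffle0r setU0 scale1r.
Qed.

(** One notion covers degree, bidegree and the space [V^{p-1,q-1}]: each is spanned by the [bas K]
    with [K] in some class. *)
Definition supp (P : pred {set 'I_(n + n)}) a := forall K, a K != 0 -> P K.

Lemma supp0 P : supp P 0. Proof. by move=> K; rewrite cf0 eqxx. Qed.
Lemma suppD P a b : supp P a -> supp P b -> supp P (a + b).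
Proof.
move=> Pa Pb K; rewrite cfD; case: (eqVneq (a K) 0) => [->|/Pa//].
by rewrite add0r => /Pb.
Qed.
Lemma suppZ P x a : supp P a -> supp P (x *: a).
Proof. by move=> Pa K; rewrite cfZ mulf_eq0 negb_or => /andP[_ /Pa]. Qed.
Lemma suppB P a b : supp P a -> supp P b -> supp P (a - b).
Proof. by move=> Pa Pb; rewrite -scaleN1r; apply/suppD/suppZ. Qed.
Lemma supp_sum P (T : Type) (r : seq T) (Q : pred T) (F : T -> form) :
  (forall t, Q t -> supp P (F t)) -> supp P (\sum_(t <- r | Q t) F t).
Proof. by move=> PF; elim/big_ind: _ => //; [exact: supp0|exact: suppD]. Qed.
Lemma supp_bas (P : pred {set 'I_(n + n)}) K : P K -> supp P (bas K).
Proof. by move=> PK L; rewrite basE; case: (eqVneq L K) => [->|_]; rewrite ?eqxx. Qed.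
Lemma suppP P a : supp P a -> a = \sum_(K | P K) a K *: bas K.
Proof.
move=> Pa; rewrite {1}[a]cform_basis big_mkcond [RHS]big_mkcond; apply: eq_bigr => K _.
by case: ifP => // /negP nPK; case: (eqVneq (a K) 0) => [->|/Pa //]; rewrite scale0r.
Qed.

Lemma supp_wedge (P P' Q : pred {set 'I_(n + n)}) a b :
  (forall I J, [disjoint I & J] -> P I -> P' J -> Q (I :|: J)) ->
  supp P a -> supp P' b -> supp Q (a \w b).
Proof.
move=> PQ Pa Pb; rewrite (suppP Pa) (suppP Pb) wedge_suml.
apply: supp_sum => I PI; rewrite wedge_sumr; apply: supp_sum => J PJ.
rewrite wedgeZl wedgeZr wedge_bas; do 2!apply: suppZ.
by case: ifP => [dIJ|_]; [apply/suppZ/supp_bas/PQ|exact: supp0].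
Qed.

Definition homog k := supp (fun K => #|K| == k).

Lemma wedgeC j k a b : homog j a -> homog k b -> a \w b = (-1) ^+ (j * k) *: (b \w a).
Proof.
move=> ha hb; rewrite (suppP ha) (suppP hb) wedge_suml wedge_sumr scaler_sumr.
apply: eq_bigr => I /eqP cI; rewrite wedge_sumr wedge_suml scaler_sumr.
apply: eq_bigr => J /eqP cJ; rewrite !wedgeZl !wedgeZr !wedge_bas disjoint_sym.
case: ifP => dIJ; last by rewrite !scaler0.
rewrite setUC !scalerA; congr (_ *: _).
by rewrite (shuffle_swap (I:=I)) 1?disjoint_sym // cI cJ; ring.
Qed.

End Wedge.

(** * Conjugation and bidegree *)

Section Conj.
Variables (C : numClosedFieldType) (n : nat).
Local Notation form := (cform C n).
Implicit Types (a b c : form) (I J K L : {set 'I_(n + n)}) (p q : nat).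

Lemma mem_holo (i : 'I_(n + n)) : (i \in holo_idx n) = (i < n)%N.
Proof.
apply/imsetP/idP => [[k _ ->] //|lt_in]; first exact: (ltn_ord k).
by exists (Ordinal lt_in) => //; apply/val_inj.
Qed.

Lemma mem_anti (i : 'I_(n + n)) : (i \in anti_idx n) = (n <= i)%N.
Proof.
apply/imsetP/idP => [[k _ ->] /=|le_ni]; first exact: leq_addr.
have lt_in : (i - n < n)%N by have := ltn_ord i; lia.
by exists (Ordinal lt_in) => //; apply/val_inj => /=; lia.
Qed.

Lemma swap_idxl (k : 'I_n) : swap_idx (lshift n k) = rshift n k.
Proof. by rewrite /swap_idx (unsplitK (inl k)). Qed.
Lemma swap_idxr (k : 'I_n) : swap_idx (rshift n k) = lshift n k.
Proof. by rewrite /swap_idx (unsplitK (inr k)). Qed.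

Lemma swap_idxE (i : 'I_(n + n)) : swap_idx i = (if (i < n)%N then n + i else i - n)%N :> nat.
Proof.
rewrite -[ i ]splitK; case: (split i) => k; rewrite /= ?swap_idxl ?swap_idxr /=.
  by rewrite ltn_ord.
by rewrite ltnNge leq_addr /= addKn.
Qed.

Lemma swap_idxK : involutive (@swap_idx n).
Proof. by move=> i; rewrite -[ i ]splitK; case: (split i) => k /=; rewrite ?(swap_idxl, swap_idxr). Qed.

Lemma swap_set_involutive K : @swap_idx n @: (@swap_idx n @: K) = K.
Proof.
rewrite -imset_comp (eq_imset (g := id)) ?imset_id //.
exact: swap_idxK.
Qed.

Lemma mem_swap_set i K : (i \in @swap_idx n @: K) = (swap_idx i \in K).
Proof. by rewrite -{1}[ i ]swap_idxK mem_imset //; apply/can_inj/swap_idxK. Qed.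

Definition hdeg K := #|K :&: holo_idx n|.
Definition adeg K := #|K :&: anti_idx n|.

Lemma swap_holo : @swap_idx n @: holo_idx n = anti_idx n.
Proof. by apply/setP => i; rewrite mem_swap_set mem_holo mem_anti swap_idxE; have := ltn_ord i; case: (ltnP i n) => ? ?; apply/idP/idP; lia. Qed.
Lemma swap_anti : @swap_idx n @: anti_idx n = holo_idx n.
Proof. by rewrite -swap_holo swap_set_involutive. Qed.

Lemma hdeg_swap K : hdeg (@swap_idx n @: K) = adeg K.
Proof.
rewrite /hdeg /adeg -swap_anti -imsetI; last by move=> ????; apply/can_inj/swap_idxK.
by rewrite card_imset //; apply/can_inj/swap_idxK.
Qed.
Lemma adeg_swap K : adeg (@swap_idx n @: K) = hdeg K.
Proof. by rewrite -hdeg_swap swap_set_involutive. Qed.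

Lemma card_hadeg K : #|K| = (hdeg K + adeg K)%N.
Proof.
rewrite /hdeg /adeg -(cardsID (holo_idx n) K); congr (_ + _)%N; congr #|pred_of_set _|.
by apply/setP => i; rewrite !inE mem_holo mem_anti -leqNgt andbC.
Qed.

Lemma hdegU I J : [disjoint I & J] -> hdeg (I :|: J) = (hdeg I + hdeg J)%N.
Proof.
move=> dIJ; rewrite /hdeg setIUl cardsU setIIl -setIA [_ :&: (J :&: _)]setICA.
by rewrite !setIA (disjoint_setI0 dIJ) !set0I cards0 subn0.
Qed.
Lemma adegU I J : [disjoint I & J] -> adeg (I :|: J) = (adeg I + adeg J)%N.
Proof.
move=> dIJ; rewrite -!hdeg_swap imsetU hdegU // -setI_eq0 -imsetI; last by move=> ????; apply/can_inj/swap_idxK.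
by rewrite (disjoint_setI0 dIJ) imset0.
Qed.

Lemma disjoint_swap I J : [disjoint @swap_idx n @: I & @swap_idx n @: J] = [disjoint I & J].
Proof.
rewrite -!setI_eq0 -imsetI ?imset_eq0 //; by move=> ????; apply/can_inj/swap_idxK.
Qed.

Lemma card_setI_sum (A B : {set 'I_(n + n)}) : #|A :&: B| = (\sum_(i in A) (i \in B))%N.
Proof.
rewrite -sum1_card big_mkcond [RHS]big_mkcond; apply: eq_bigr => i _.
by rewrite inE; case: (i \in A); case: (i \in B).
Qed.

(** Spreads a bidegree sign over pairs of indices, to be matched with [shuffle_prod] factor by
    factor. *)
Lemma prod_sign_deg I J (A B : {set 'I_(n + n)}) :
  \prod_(i in I) \prod_(j in J) (-1 : C) ^+ ((i \in A) * (j \in B)) = (-1) ^+ (#|I :&: A| * #|J :&: B|).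
Proof.
under eq_bigr do rewrite prodrXr -big_distrr /=.
by rewrite prodrXr -big_distrl /= -!card_setI_sum.
Qed.

(** Exchanging the two halves of the index range keeps the order of two indices of the same type and
    reverses the order of a holomorphic and an antiholomorphic one. The signs count these mixed
    pairs. *)
Lemma shuffle_conj I J :
  shuffle_sign C (@swap_idx n @: I) (@swap_idx n @: J) =
  shuffle_sign C I J * (-1) ^+ (hdeg I * adeg J) * (-1) ^+ (adeg I * hdeg J).
Proof.
have sinj : injective (@swap_idx n) by apply/can_inj/swap_idxK.
rewrite !shuffle_prod big_imset /=; last by move=> ????; apply: sinj.
rewrite -!prod_sign_deg -!big_split; apply: eq_bigr => i iI.
rewrite big_imset /=; last by move=> ????; apply: sinj.
rewrite -!big_split; apply: eq_bigr => j jJ /=.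
rewrite !mem_holo !mem_anti !swap_idxE -!exprD -signr_odd -[RHS]signr_odd; congr ((-1) ^+ _).
have := ltn_ord i; have := ltn_ord j; case: (ltnP i n); case: (ltnP j n) => /=; lia.
Qed.

Lemma shuffle_conjC I J : (shuffle_sign C I J)^* = shuffle_sign C I J.
Proof. exact: rmorph_sign. Qed.

Lemma fconjD a b : fconj (a + b) = fconj a + fconj b.
Proof. by apply/ffunP=> K; rewrite cfD !ffunE rmorphD mulrDr. Qed.
Lemma fconj0 : fconj (0 : form) = 0.
Proof. by apply/ffunP=> K; rewrite !ffunE rmorph0 mulr0. Qed.
Lemma fconjZ x a : fconj (x *: a) = x^* *: fconj a.
Proof. by apply/ffunP=> K; rewrite cfZ !ffunE rmorphM mulrCA. Qed.
Lemma fconjB a b : fconj (a - b) = fconj a - fconj b.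
Proof. by rewrite -scaleN1r fconjD fconjZ rmorphN rmorph1 scaleN1r. Qed.
Lemma fconj_sum (T : Type) (r : seq T) (P : pred T) (F : T -> form) :
  fconj (\sum_(t <- r | P t) F t) = \sum_(t <- r | P t) fconj (F t).
Proof. by apply: (big_morph _ fconjD fconj0). Qed.

Lemma fconj_bas K : fconj (bas C K) = (-1) ^+ (hdeg K * adeg K) *: bas C (@swap_idx n @: K).
Proof.
apply/ffunP=> L; rewrite cfZ ffunE !basE.
rewrite -[in RHS](inj_eq (imset_inj (can_inj swap_idxK))) swap_set_involutive.
case: eqP => [<-|_]; last by rewrite rmorph0 !mulr0.
by rewrite hdeg_swap adeg_swap mulnC rmorph1.
Qed.

(** The sign in [fconj_bas] is quadratic in the bidegree; its cross terms for a union cancel the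
    signs of [shuffle_conj]. *)
Lemma fconjM a b : fconj (a \w b) = fconj a \w fconj b.
Proof.
rewrite [a]cform_basis [b]cform_basis.
rewrite wedge_suml !fconj_sum wedge_suml; apply: eq_bigr => I _.
rewrite !wedge_sumr fconj_sum; apply: eq_bigr => J _.
rewrite !(wedgeZl, wedgeZr, fconjZ); congr (_ *: (_ *: _)).
rewrite !fconj_bas !(wedgeZl, wedgeZr) !wedge_bas disjoint_swap.
case: ifP => [dIJ|_]; last by rewrite fconj0 !scaler0.
rewrite fconjZ fconj_bas imsetU !scalerA; congr (_ *: _).
rewrite hdegU // adegU // shuffle_conj shuffle_conjC mulnDl !mulnDr !exprD.
rewrite [(adeg I * _)%N]mulnC; move: (shuffle_sign _ _ _) => s.
do 4!move: ((-1) ^+ _) => ?; ring.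
Qed.

Lemma fconjK : involutive (@fconj C n).
Proof.
move=> a; rewrite [a]cform_basis !fconj_sum; apply: eq_bigr => K _.
rewrite !fconjZ conjCK; congr (_ *: _); rewrite fconj_bas fconjZ fconj_bas swap_set_involutive rmorph_sign scalerA.
by rewrite hdeg_swap adeg_swap [(adeg K * _)%N]mulnC -expr2 sqrr_sign scale1r.
Qed.

Lemma fconj1 : fconj (form1 C n) = form1 C n.
Proof. by rewrite form1E fconj_bas imset0 /hdeg set0I cards0 expr0 scale1r. Qed.

Definition pqset p q : pred {set 'I_(n + n)} := fun K => (hdeg K == p) && (adeg K == q).

Lemma is_pqE p q a : is_pq p q a <-> supp (pqset p q) a.
Proof.
split=> H K /H; first by case=> h1 h2; rewrite /pqset /hdeg /adeg h1 h2 !eqxx.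
by case/andP => /eqP ? /eqP ?.
Qed.

Lemma pq_wedge p q p' q' a b : is_pq p q a -> is_pq p' q' b -> is_pq (p + p') (q + q') (a \w b).
Proof.
rewrite !is_pqE; apply: supp_wedge => I J dIJ /andP[/eqP <- /eqP <-] /andP[/eqP <- /eqP <-].
by rewrite /pqset hdegU // adegU // !eqxx.
Qed.

Lemma pq_fconj p q a : is_pq p q a -> is_pq q p (fconj a).
Proof.
rewrite !is_pqE => /suppP ->; rewrite fconj_sum; apply: supp_sum => K /andP[/eqP hK /eqP aK].
rewrite fconjZ fconj_bas; do 2!apply: suppZ; apply: supp_bas.
by rewrite /pqset hdeg_swap adeg_swap hK aK !eqxx.
Qed.

Lemma pq_homog p q a : is_pq p q a -> homog (p + q) a.
Proof. by rewrite is_pqE => H K /H /andP[/eqP <- /eqP <-]; rewrite card_hadeg. Qed.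

Lemma pq_sum p q (T : Type) (r : seq T) (P : pred T) (F : T -> form) :
  (forall t, P t -> is_pq p q (F t)) -> is_pq p q (\sum_(t <- r | P t) F t).
Proof. by move=> H; apply/is_pqE/supp_sum => t /H /is_pqE. Qed.
Lemma pqZ p q x a : is_pq p q a -> is_pq p q (x *: a).
Proof. by rewrite !is_pqE; apply: suppZ. Qed.
Lemma pqB p q a b : is_pq p q a -> is_pq p q b -> is_pq p q (a - b).
Proof. by rewrite !is_pqE; apply: suppB. Qed.
Lemma pq0 p q : is_pq p q (0 : form).
Proof. by rewrite is_pqE; apply: supp0. Qed.

Lemma dzE (k : 'I_n) : dz C k = bas C [set lshift n k].
Proof. by []. Qed.

Lemma hdeg_l (k : 'I_n) : hdeg [set lshift n k] = 1%N.
Proof. by rewrite /hdeg (setIidPl _) ?cards1 // sub1set mem_holo /=. Qed.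
Lemma adeg_l (k : 'I_n) : adeg [set lshift n k] = 0%N.
Proof. by have := card_hadeg [set lshift n k]; rewrite cards1 hdeg_l => -[]. Qed.

Lemma pq_dz (k : 'I_n) : is_pq 1 0 (dz C k).
Proof. by rewrite is_pqE; apply: supp_bas; rewrite /pqset hdeg_l adeg_l. Qed.
Lemma pq_dw A (k : 'I_n) : is_pq 1 0 (dw (A : 'M[C]_n) k).
Proof. by apply: pq_sum => l _; apply/pqZ/pq_dz. Qed.
Lemma pq_kahler_std A (l : 'I_n) : is_pq 1 1 (kahler_std (A : 'M[C]_n) l).
Proof. by apply: pqZ; apply: (@pq_wedge 1 0 0 1); [|apply: pq_fconj]; apply: pq_dw. Qed.

Lemma conj_half_i : ('i / 2 : C)^* = - ('i / 2).
Proof. by rewrite rmorphM /= conjCi fmorphV rmorph_nat mulNr. Qed.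

(** The sign from conjugating ['i / 2] cancels the sign from exchanging two 1-forms. *)
Lemma kahler_std_real A (l : 'I_n) : fconj (kahler_std (A : 'M[C]_n) l) = kahler_std A l.
Proof.
have h1 := pq_homog (@pq_dw A l); have h2 := pq_homog (pq_fconj (@pq_dw A l)).
rewrite /kahler_std fconjZ fconjM fconjK (wedgeC h2 h1) scalerA; congr (_ *: _).
by rewrite conj_half_i expr1 mulrN1 opprK.
Qed.

Lemma kahler_pq w : kahler w -> is_pq 1 1 (w : form).
Proof. by case=> A [_ ->]; apply: pq_sum => l _; apply: pq_kahler_std. Qed.
Lemma kahler_real w : kahler w -> fconj w = w :> form.
Proof. by case=> A [_ ->]; rewrite fconj_sum; apply: eq_bigr => l _; apply: kahler_std_real. Qed.

End Conj.

(** * Linear changes of coordinates *)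

Section ChangeOfCoordinates.
Variables (C : numClosedFieldType) (n : nat).
Local Notation form := (cform C n).
Local Notation bas := (bas C).
Implicit Types (i : 'I_(n + n)) (a b c : form) (I J K L : {set 'I_(n + n)}) (p q : nat) (A B : 'M[C]_n).

Definition below (i : 'I_(n + n)) K := [forall j in K, (i < j)%N].

Lemma belowP i K : reflect (forall j, j \in K -> (i < j)%N) (below i K).
Proof. exact: (iffP forall_inP). Qed.

Lemma below_notin i K : below i K -> i \notin K.
Proof. by move/belowP=> H; apply/negP => /H; rewrite ltnn. Qed.

Lemma below_disjoint i K : i \notin K -> [disjoint [set i] & K].
Proof. by rewrite disjoints1. Qed.

(** Adding a new smallest index is wedging on the left without a sign ([bas_below]), so this
    induction avoids shuffle signs. *)
Lemma set_below_ind (P : {set 'I_(n + n)} -> Prop) :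
  P set0 -> (forall i K, below i K -> P K -> P (i |: K)) -> forall K, P K.
Proof.
move=> P0 PU K; move: {2}#|K| (erefl #|K|) => m; elim: m K => [K /eqP|m IHm K cK].
  by rewrite cards_eq0 => /eqP ->.
have /card_gt0P[k0 k0K] : (0 < #|K|)%N by rewrite cK.
case: (arg_minnP (P := mem K) (@nat_of_ord _) k0K) => k kK kmin.
rewrite -(setD1K kK); apply: PU; last first.
  by apply: IHm; move: cK; rewrite (cardsD1 k) (_ : k \in K) // => -[].
apply/belowP => j; rewrite !inE => /andP[jk jK].
by rewrite ltn_neqAle (inj_eq val_inj) eq_sym jk kmin.
Qed.

Lemma shuffle_below i K : below i K -> shuffle_sign C [set i] K = 1.
Proof.
move/belowP => iK; rewrite shuffle_prod big_set1 big1 // => j /iK; by case: ltngtP.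
Qed.

Lemma bas_below i K : below i K -> bas (i |: K) = bas [set i] \w bas K.
Proof.
move=> iK; rewrite wedge_bas below_disjoint ?below_notin //.
by rewrite shuffle_below // scale1r.
Qed.

Lemma homog1_sqr a : homog 1 a -> a \w a = 0.
Proof.
move=> ha; have := wedgeC ha ha; rewrite muln1 expr1 scaleN1r => /eqP.
by rewrite -addr_eq0 -mulr2n -scaler_nat scaler_eq0 pnatr_eq0 => /eqP.
Qed.

Lemma homog_bas1 i : homog 1 (bas [set i]).
Proof. by apply: supp_bas; rewrite /= cards1. Qed.

(** The generators [dz_k], [dzbar_k] determine an algebra endomorphism. *)
Lemma alg_ext (f g : {linear form -> form}) :
  f (form1 C n) = g (form1 C n) ->
  (forall a b, f (a \w b) = f a \w f b) -> (forall a b, g (a \w b) = g a \w g b) ->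
  (forall i, f (bas [set i]) = g (bas [set i])) -> f =1 g.
Proof.
move=> fg1 fM gM fg; apply: lin_ext; elim/set_below_ind => [|i K iK IH]; first exact: fg1.
by rewrite (bas_below iK) fM gM fg IH.
Qed.

Section Substitution.
Variable t : 'I_(n + n) -> form.
Hypothesis ht : forall i, homog 1 (t i).

(** [enum K] is increasing, in agreement with the order of factors in the basis element at [K]. *)
Definition subst_bas K : form := foldr (@wedge C n) (form1 C n) [seq t i | i <- enum K].
Definition subst a : form := \sum_K a K *: subst_bas K.

Fact subst_linear : linear subst.
Proof.
move=> x a b; rewrite /subst scaler_sumr -big_split; apply: eq_bigr => K _ /=.
by rewrite cfD cfZ scalerDl scalerA.
Qed.
HB.instance Definition _ := GRing.isLinear.Build C form form *:%R subst subst_linear.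

Lemma substZ x a : subst (x *: a) = x *: subst a. Proof. exact: linearZZ. Qed.
Lemma substN a : subst (- a) = - subst a. Proof. exact: linearN. Qed.
Lemma subst0 : subst 0 = 0. Proof. exact: linear0. Qed.

Lemma substE K : subst (bas K) = subst_bas K.
Proof.
rewrite /subst (bigD1 K) //= basE eqxx scale1r big1 ?addr0 // => L nLK.
by rewrite basE (negPf nLK) scale0r.
Qed.

Lemma sorted_enum_ord K : sorted (fun i j : 'I_(n + n) => (i < j)%N) (enum K).
Proof.
rewrite /enum_mem -enumT; apply: sorted_filter; first by move=> ???; apply: ltn_trans.
by rewrite -(sorted_map (f:=@nat_of_ord _) (e':=ltn)) val_enum_ord iota_ltn_sorted.
Qed.

Lemma enum_below i K : below i K -> enum (i |: K) = i :: enum K.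
Proof.
move=> iK; apply: (@irr_sorted_eq _ (fun i j : 'I_(n + n) => (i < j)%N)).
- by move=> ???; apply: ltn_trans.
- by move=> ?; apply: ltnn.
- exact: sorted_enum_ord.
- rewrite /= path_sortedE; last by move=> ???; apply: ltn_trans.
  rewrite sorted_enum_ord andbT.
  by apply/allP => j; rewrite mem_enum; move/belowP: iK; apply.
- by move=> j; rewrite inE !mem_enum !inE.
Qed.

Lemma subst1 : subst (form1 C n) = form1 C n.
Proof. by rewrite [X in subst X]form1E substE /subst_bas enum_set0. Qed.

Lemma subst_below i K : below i K -> subst (bas [set i] \w bas K) = t i \w subst (bas K).
Proof. by move=> iK; rewrite -bas_below // !substE /subst_bas enum_below. Qed.

Lemma subst_gen i : subst (bas [set i]) = t i.
Proof.
have /subst_below : below i set0 by apply/belowP => j; rewrite inE.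
by rewrite -form1E wedge1r subst1 wedge1r.
Qed.

Lemma anticomm_t i j a : t i \w (t j \w a) = - (t j \w (t i \w a)).
Proof. by rewrite !wedgeA (wedgeC (@ht i) (@ht j)) muln1 expr1 scaleN1r -scaleN1r wedgeZl scaleN1r. Qed.

(** Compare [i] with the smallest index [k] of the set: if smaller, the product is already sorted;
    if larger, both sides anticommute [i] past [k] and induction applies; if equal, both sides
    contain a square and vanish. *)
Lemma subst_gen_bas i K : subst (bas [set i] \w bas K) = t i \w subst (bas K).
Proof.
move: K i; elim/set_below_ind => [|k K kK IH] i.
  by rewrite -form1E wedge1r subst_gen subst1 wedge1r.
case: (ltngtP i k) => [lt_ik|lt_ki|/val_inj ->].
- apply: subst_below; apply/belowP => j; rewrite !inE => /predU1P[-> //|jK].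
  by apply: (ltn_trans lt_ik); move/belowP: kK; apply.
- rewrite (bas_below kK) (subst_below kK) anticomm_t -IH.
  rewrite wedgeA (wedgeC (@homog_bas1 i) (@homog_bas1 k)) muln1 expr1 wedgeZl scaleN1r substN -wedgeA.
  congr (- _); rewrite (wedge_bas C [set i] K); case: ifP => [dK|_]; last by rewrite wedge0r subst0 wedge0r.
  rewrite wedgeZr !substZ wedgeZr subst_below //.
  by apply/belowP => j; rewrite !inE => /predU1P[-> //|jK]; move/belowP: kK; apply.
- rewrite (bas_below kK) (subst_below kK) !wedgeA !homog1_sqr //; last exact: homog_bas1.
  by rewrite !wedge0l subst0.
Qed.

Lemma substM a b : subst (a \w b) = subst a \w subst b.
Proof.
apply: (@lin_ext _ _ (subst \o wedge a) (wedge (subst a) \o subst)) => L /=.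
apply: (@lin_ext _ _ (subst \o wedger (bas L)) (wedger (subst (bas L)) \o subst)) => K /=.
rewrite /wedger; move: K; elim/set_below_ind => [|i K iK IH].
  by rewrite -form1E subst1 !wedge1l.
rewrite (bas_below iK) -wedgeA (subst_below iK) -wedgeA -IH.
apply: (@lin_ext _ _ (subst \o wedge (bas [set i])) (wedge (t i) \o subst)) => K' /=.
exact: subst_gen_bas.
Qed.

End Substitution.

Definition coord A (i : 'I_(n + n)) : form :=
  match split i with inl k => dw A k | inr k => fconj (dw A k) end.

Lemma coord_l A k : coord A (lshift n k) = dw A k.
Proof. by rewrite /coord (unsplitK (inl k)). Qed.
Lemma coord_r A k : coord A (rshift n k) = fconj (dw A k).
Proof. by rewrite /coord (unsplitK (inr k)). Qed.

Lemma coord_homog A i : homog 1 (coord A i).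
Proof.
rewrite -[ i ]splitK; case: (split i) => k /=; rewrite ?coord_l ?coord_r.
  exact: (pq_homog (@pq_dw _ _ A k)).
exact: (pq_homog (pq_fconj (@pq_dw _ _ A k))).
Qed.

Definition change A : form -> form := subst (coord A).
HB.instance Definition _ A := GRing.Linear.on (change A).

Lemma changeM A a b : change A (a \w b) = change A a \w change A b.
Proof. exact/substM/coord_homog. Qed.
Lemma change1 A : change A (form1 C n) = form1 C n.
Proof. exact: subst1. Qed.
Lemma changeD A a b : change A (a + b) = change A a + change A b.
Proof. exact: linearD. Qed.
Lemma changeZ A x a : change A (x *: a) = x *: change A a.
Proof. exact: linearZZ. Qed.
Lemma change_sum A (T : Type) (r : seq T) (P : pred T) (F : T -> form) :
  change A (\sum_(t <- r | P t) F t) = \sum_(t <- r | P t) change A (F t).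
Proof. exact: linear_sum. Qed.
Lemma change_dz A k : change A (dz C k) = dw A k.
Proof. by rewrite /change dzE subst_gen coord_l. Qed.

Lemma bas_rshift k : bas [set rshift n k] = fconj (dz C k).
Proof. by rewrite dzE fconj_bas hdeg_l adeg_l expr0 scale1r imset_set1 swap_idxl. Qed.

(** Conjugating [change A] by [fconj] on both sides gives a map that is again complex linear and
    multiplicative, so [alg_ext] compares it with [change A] on generators. *)
Lemma change_fconj A a : change A (fconj a) = fconj (change A a).
Proof.
apply: (canRL (@fconjK C n)).
pose f b := fconj (change A (fconj b)).
have lf : linear f by move=> x b c; rewrite /f fconjD fconjZ changeD changeZ fconjD fconjZ conjCK.
pose F : {linear form -> form} := HB.pack f (GRing.isLinear.Build C form form *:%R f lf).
apply: (@alg_ext F (change A)) => /=.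
- by rewrite /F /= /f fconj1 change1 fconj1.
- by move=> b c; rewrite /F /= /f fconjM changeM fconjM.
- exact: changeM.
move=> i; rewrite /F /= /f -[ i ]splitK; case: (split i) => k /=.
  by rewrite -bas_rshift -dzE change_dz /change subst_gen coord_r fconjK.
by rewrite bas_rshift fconjK change_dz /change -bas_rshift subst_gen coord_r.
Qed.

(** [change] is a pullback, hence contravariant: [change A] after [change B] belongs to [B *m A]. *)
Lemma change_dw A B l : change A (dw B l) = dw (B *m A) l.
Proof.
rewrite /dw change_sum; under eq_bigr do rewrite changeZ change_dz /dw scaler_sumr.
rewrite exchange_big; apply: eq_bigr => j _ /=; rewrite mxE scaler_suml.
by apply: eq_bigr => k _; rewrite scalerA.
Qed.

Lemma dw1 k : dw (1%:M : 'M[C]_n) k = dz C k.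
Proof.
rewrite /dw (bigD1 k) //= mxE eqxx scale1r big1 ?addr0 // => l.
by rewrite mxE eq_sym => /negPf ->; rewrite scale0r.
Qed.

Lemma change_kahler_std A B l : change A (kahler_std B l) = kahler_std (B *m A) l.
Proof. by rewrite /kahler_std changeZ changeM change_fconj change_dw. Qed.

Lemma change_kahler A w : A \in unitmx -> kahler w -> kahler (change A w).
Proof.
move=> uA [B [uB ->]]; exists (B *m A); split; first by rewrite unitmx_mul uB.
by rewrite change_sum; apply: eq_bigr => l _; rewrite change_kahler_std.
Qed.

Lemma changeK A B a : B *m A = 1%:M -> change A (change B a) = a.
Proof.
move=> BA1; apply: (@alg_ext (change A \o change B) idfun) => //=.
- by rewrite !change1.
- by move=> b c; rewrite !changeM.
move=> i; rewrite -[ i ]splitK; case: (split i) => k /=.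
  by rewrite -dzE change_dz change_dw BA1 dw1.
by rewrite bas_rshift !change_fconj change_dz change_dw BA1 dw1.
Qed.

Lemma change_bas_pq A K : is_pq (hdeg K) (adeg K) (change A (bas K)).
Proof.
elim/set_below_ind: K => [|i K iK IH].
  by rewrite -form1E change1 form1E is_pqE; apply: supp_bas; rewrite /pqset !eqxx.
have diK := below_disjoint (below_notin iK).
rewrite hdegU // adegU // (bas_below iK) changeM; apply: pq_wedge => //.
rewrite /change subst_gen -[ i ]splitK; case: (split i) => k /=.
  by rewrite coord_l hdeg_l adeg_l; apply: pq_dw.
rewrite coord_r -swap_idxl -imset_set1 hdeg_swap adeg_swap hdeg_l adeg_l.
exact/pq_fconj/pq_dw.
Qed.

Lemma change_pq A p q a : is_pq p q a -> is_pq p q (change A a).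
Proof.
rewrite {1}is_pqE => /suppP ->; rewrite change_sum; apply: pq_sum => K /andP[/eqP <- /eqP <-].
by rewrite changeZ; apply/pqZ/change_bas_pq.
Qed.

(** [V^{n,n}] is a line and [change] preserves bidegree, so only the top basis element contributes.
    The scalar is the determinant of the substitution on all 2n generators. *)
Lemma change_top A a : change A a setT = a setT * change A (bas setT) setT.
Proof.
rewrite {1}[a]cform_basis change_sum cf_sum (bigD1 setT) //= changeZ cfZ big1 ?addr0 // => K nK.
rewrite changeZ cfZ; case: (eqVneq (change A (bas K) setT) 0) => [->|/(change_bas_pq)[hK aK]].
  by rewrite mulr0.
suff: K == setT by rewrite (negPf nK).
by rewrite eqEcard subsetT /= [#|K|]card_hadeg -hK -aK -card_hadeg.
Qed.

Lemma change_top_neq0 A : A \in unitmx -> change A (bas setT) setT != 0.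
Proof.
move=> uA; apply/eqP => c0; have := changeK (bas setT) (mulVmx uA) => /ffunP/(_ setT).
by rewrite change_top c0 mulr0 basE eqxx => /eqP; rewrite eq_sym oner_eq0.
Qed.

End ChangeOfCoordinates.

(** * Invariance of HLT, HRR and LD under linear changes of coordinates *)

Section Transport.
Variables (C : numClosedFieldType) (n : nat).
Local Notation form := (cform C n).
Implicit Types (a b c w Om : form) (p q : nat).
Variable A : 'M[C]_n.
Hypothesis uA : A \in unitmx.
Local Notation T := (@change C n A).
Local Notation T' := (@change C n (invmx A)).

Lemma changeVK a : T' (T a) = a. Proof. exact/changeK/mulmxV. Qed.
Lemma changeKV a : T (T' a) = a. Proof. exact/changeK/mulVmx. Qed.

Lemma wpowS w k : wpow w k.+1 = w \w wpow w k. Proof. by []. Qed.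

Lemma change_wpow w k : wpow (T w) k = T (wpow w k).
Proof.
elim: k => [|k IH]; first exact/esym/change1.
by rewrite wpowS [in RHS]wpowS changeM IH.
Qed.

(** Numerator and denominator are multiplied by the same nonzero top coefficient. *)
Lemma change_star w a : star (T w) (T a) = star w a.
Proof.
have t0 := change_top_neq0 uA; rewrite /star change_wpow (change_top A a) (change_top A (wpow w n)).
move: (change _ _ _) t0 => t t0; rewrite !invfM invrK.
by rewrite -[RHS]mulr1 -(mulfV t0); ring.
Qed.

Lemma change_Qform w Om p q a b : Qform (T w) (T Om) p q (T a) (T b) = Qform w Om p q a b.
Proof. by rewrite /Qform -change_fconj -!changeM change_star. Qed.

Lemma change_eq0 a : T a = 0 -> a = 0.
Proof. by move=> Ta0; rewrite -[a]changeVK Ta0 linear0. Qed.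

Lemma change_HLT Om p q : HLT Om p q -> HLT (T Om) p q.
Proof.
case=> inj surj; split.
  move=> a /(change_pq (A := invmx A)) pa; rewrite -[a]changeKV -changeM => /change_eq0 /(inj _ pa) e.
  by rewrite -[LHS]changeKV changeKV e !linear0.
move=> b /(change_pq (A := invmx A)) /surj[a [pa e]]; exists (T a); split; first exact: change_pq.
by rewrite -changeM e changeKV.
Qed.

Lemma change_primitive w Om p q a :
  primitive (T w) (T Om) p q (T a) <-> primitive w Om p q a.
Proof.
split=> -[pa e]; split; last 2 first.
- exact: change_pq.
- by rewrite -!changeM e linear0.
- by have := change_pq (A := invmx A) pa; rewrite changeVK.
- by move: e; rewrite -!changeM => /change_eq0.
Qed.

Lemma change_HRR w Om p q : HRR w Om p q -> HRR (T w) (T Om) p q.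
Proof.
move=> H a; rewrite -[a]changeKV => /change_primitive Pa nz; rewrite change_Qform.
by apply: H => //; apply: contraNneq nz => ->; rewrite linear0.
Qed.

Lemma change_in_lower p q b : in_lower p q (T b) <-> in_lower p q b.
Proof.
rewrite /in_lower; case: ifP => _; split.
- exact: change_eq0.
- by move=> ->; rewrite linear0.
- by move/(change_pq (A := invmx A)); rewrite changeVK.
- exact: change_pq.
Qed.

Lemma change_LD w Om p q : LD w Om p q -> LD (T w) (T Om) p q.
Proof.
case=> dec [inj ort]; split; [|split].
- move=> a /(change_pq (A := invmx A)) /dec[b [c [lb [pc e]]]].
  exists (T b), (T c); split; first exact/change_in_lower.
  split; first exact/change_primitive.
  by rewrite -changeM -changeD -e changeKV.
- move=> b; rewrite -[b]changeKV => /change_in_lower lb; rewrite -changeM => /change_primitive pb.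
  by rewrite inj // linear0.
- move=> b c; rewrite -[b]changeKV -[c]changeKV => /change_in_lower lb /change_primitive pc.
  by rewrite -changeM !change_Qform; apply: ort.
Qed.

End Transport.

(** * Hodge-Riemann relations from an index count *)

Section Lefschetz.
Variables (C : numClosedFieldType) (n : nat).
Local Notation form := (cform C n).
Implicit Types (a b c h w Om : form) (p q : nat) (K : {set 'I_(n + n)}).

Lemma homog_evenC k a b : ~~ odd k -> homog k a -> a \w b = b \w a.
Proof.
move=> ek ha; apply: (@lin_ext _ _ (wedge a) (wedger a)) => K /=.
have hK : homog #|K| (bas C K) by apply: supp_bas; rewrite /= eqxx.
by rewrite /wedger (wedgeC ha hK) -signr_odd oddM (negPf ek) scale1r.
Qed.

Definition restr (P : pred {set 'I_(n + n)}) a : form := [ffun K => if P K then a K else 0].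

(** An injective endomorphism of a finite dimensional space is surjective, applied to the subspace
    of forms supported in [P]. *)
Lemma endo_surj (P : pred {set 'I_(n + n)}) (f : {linear form -> form}) :
  (forall a, supp P a -> supp P (f a)) -> (forall a, supp P a -> f a = 0 -> a = 0) ->
  forall b, supp P b -> exists a, supp P a /\ f a = b.
Proof.
move=> fP finj.
have suppr a : supp P (restr P a) by move=> K; rewrite ffunE; case: ifP; rewrite ?eqxx.
(* Extends [f] by the identity on the complementary coordinates, so that the dimension count takes
   place on the full space of forms. *)
pose g a := f (restr P a) + (a - restr P a).
have lg : linear g.
  have lr : linear (restr P).
    move=> x a b; apply/ffunP => K; rewrite cfD cfZ !ffunE.
    by case: ifP => _; rewrite ?mulr0 ?addr0.
  move=> x a b; rewrite /g lr linearP scalerDr scalerBr opprD.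
  by rewrite [RHS]addrACA; congr (_ + _); rewrite [RHS]addrACA.
pose G : {linear form -> form} := HB.pack g (GRing.isLinear.Build C form form *:%R g lg).
have outP a K : ~~ P K -> g a K = a K.
  move=> nP; rewrite /g 2!cfD.
  have -> : (f (restr P a)) K = 0.
    by apply/eqP; apply: contraNT nP; apply: fP.
  have -> : (- restr P a) K = 0 by rewrite -scaleN1r cfZ ffunE (negPf nP) mulr0.
  by rewrite add0r addr0.
have inP a : supp P (g a) -> restr P a = a.
  move=> Pg; apply/ffunP => K; rewrite ffunE; case: ifP => // /negbT nP.
  by rewrite -(outP a K nP); apply/esym/eqP; apply: contraNT nP; apply: Pg.
have ginj : injective G.
  move=> a b eab; apply/eqP; rewrite -subr_eq0; apply/eqP.
  have g0 : g (a - b) = 0 by rewrite -[g]/(G : form -> form) linearB eab subrr.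
  have r : restr P (a - b) = a - b by apply: inP; rewrite g0; apply: supp0.
  by rewrite -r; apply: finj => //; move: g0; rewrite /g r subrr addr0.
move=> b Pb.
have /lker0P ker0 : injective (linfun G) by move=> a c; rewrite !lfunE; apply: ginj.
have : b \in limg (linfun G) by rewrite lker0_limgf ?memvf.
case/memv_imgP => a _; rewrite lfunE => eb; exists a.
have ra : restr P a = a by apply: inP; move: Pb; rewrite eb.
by split; [rewrite -ra; apply: suppr | rewrite eb /= /g ra subrr addr0].
Qed.

(** Identifies [V^{n-q,n-p}] with [V^{p,q}]. *)
Definition flip a : form := [ffun K : {set 'I_(n + n)} => a (~: (@swap_idx n @: K))].

Lemma flip_linear : linear flip.
Proof. by move=> x a b; apply/ffunP=> K; rewrite cfD cfZ !ffunE. Qed.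
HB.instance Definition _ := GRing.isLinear.Build C form form *:%R flip flip_linear.

Lemma flip_inj : injective flip.
Proof.
move=> a b /ffunP e; apply/ffunP => K; have := e (@swap_idx n @: (~: (K : {set 'I_(n + n)}))).
by rewrite !ffunE swap_set_involutive setCK.
Qed.

Lemma hdegT : hdeg [set: 'I_(n + n)] = n.
Proof. by rewrite /hdeg setTI card_imset; [exact: card_ord | exact: lshift_inj]. Qed.

Lemma hdegC K : (hdeg (~: K) + hdeg K = n)%N.
Proof.
have dK : [disjoint ~: K & K] by rewrite -setI_eq0 setIC setICr.
by rewrite -hdegU // setUC setUCr hdegT.
Qed.
Lemma adegC K : (adeg (~: K) + adeg K = n)%N.
Proof.
have dK : [disjoint ~: K & K] by rewrite -setI_eq0 setIC setICr.
have := hdegC K; have := card_hadeg K; have := card_hadeg (~: K).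
have := cardsC K; rewrite card_ord; lia.
Qed.

Lemma supp_flip p q (P : pred {set 'I_(n + n)}) a :
  (forall K, (hdeg K + q = n)%N -> (adeg K + p = n)%N -> P K) ->
  is_pq p q a -> supp P (flip a).
Proof.
move=> H; rewrite is_pqE => Pa K; rewrite ffunE => /Pa /andP[/eqP h1 /eqP h2].
have := hdegC (@swap_idx n @: K); have := adegC (@swap_idx n @: K).
by rewrite h1 h2 hdeg_swap adeg_swap => e1 e2; apply: H; lia.
Qed.

(** The positivity tests make the class empty when [p] or [q] is 0, where the truncated predecessor
    would give a nonzero space. *)
Definition lowset p q : pred {set 'I_(n + n)} :=
  fun K => [&& 0 < p, 0 < q & pqset p.-1 q.-1 K]%N.

Lemma in_lowerE p q b : in_lower p q b <-> supp (lowset p q) b.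
Proof.
rewrite /in_lower /lowset; case: p => [|p]; last case: q => [|q] /=; last exact: is_pqE.
all: split=> [->|H]; first exact: supp0.
all: by apply/ffunP => K; rewrite cf0; apply/eqP; case: eqP => // /eqP /H.
Qed.

Lemma starD w a b : star w (a + b) = star w a + star w b.
Proof. by rewrite /star cfD mulrDl. Qed.
Lemma starZ w x a : star w (x *: a) = x * star w a.
Proof. by rewrite /star cfZ mulrA. Qed.
Lemma star0 w : star w 0 = 0.
Proof. by rewrite /star cf0 mul0r. Qed.

Lemma QformBl w Om p q a b c : Qform w Om p q (a - b) c = Qform w Om p q a c - Qform w Om p q b c.
Proof. by rewrite /Qform !wedgeBl -scaleN1r starD starZ mulN1r mulrBr. Qed.
Lemma QformBr w Om p q a b c : Qform w Om p q c (a - b) = Qform w Om p q c a - Qform w Om p q c b.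
Proof. by rewrite /Qform fconjB wedgeBr wedgeBl -scaleN1r starD starZ mulN1r mulrBr. Qed.

(** * From the signs of [Q] on two subspaces to HRR, HLT and LD *)

Section Main.
Variables (w Om : form) (p q : nat) (Phi : {linear form -> form}).
Hypothesis pqn : (p + q + 2 = n)%N.
Hypothesis w11 : is_pq 1 1 w.
Hypothesis wreal : fconj w = w.
Hypothesis Om22 : is_pq 2 2 Om.
Hypothesis Omreal : fconj Om = Om.
Hypothesis Qneg : forall b, in_lower p q b -> b != 0 -> Qform w Om p q (w \w b) (w \w b) < 0.
Hypothesis Phi_lower : forall a, is_pq p q a -> in_lower p q (Phi a).
Hypothesis Qpos : forall h, is_pq p q h -> Phi h = 0 -> h != 0 -> 0 < Qform w Om p q h h.

Lemma kahlerC a : w \w a = a \w w. Proof. exact: (homog_evenC _ _ (pq_homog w11)). Qed.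
Lemma OmC a : Om \w a = a \w Om. Proof. exact: (homog_evenC _ _ (pq_homog Om22)). Qed.

(** [w] and [Om] are real and of even degree: the conjugate of [c] is killed by the same product,
    and [w] can be moved next to [Om]. *)
Lemma Qorth_r b c : primitive w Om p q c -> Qform w Om p q (w \w b) c = 0.
Proof.
case=> _ e; have e' : fconj c \w (Om \w w) = 0 by rewrite wedgeA -Omreal -wreal -!fconjM e fconj0.
by rewrite /Qform -!wedgeA kahlerC -!wedgeA e' wedge0r star0 mulr0.
Qed.

Lemma Qorth_l b c : primitive w Om p q c -> Qform w Om p q c (w \w b) = 0.
Proof.
case=> _ e; have e' : c \w (Om \w w) = 0 by rewrite wedgeA.
by rewrite /Qform fconjM wreal -[_ \w Om]OmC wedgeA OmC -wedgeA [Om \w _]wedgeA wedgeA e' wedge0l star0 mulr0.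
Qed.

Lemma lower_pq b : in_lower p q b -> is_pq p q (w \w b).
Proof.
rewrite /in_lower; case: ifP => [_ ->|/norP[p0 q0] pb]; first by rewrite wedge0r; apply: pq0.
have := pq_wedge w11 pb; rewrite !add1n !prednK ?lt0n //.
Qed.

Lemma lower_primitive_eq0 b : in_lower p q b -> primitive w Om p q (w \w b) -> b = 0.
Proof.
move=> lb pb; apply/eqP; apply: contraT => nb.
by have := Qneg lb nb; rewrite Qorth_r // ltxx.
Qed.

Lemma hodge_riemann : HRR w Om p q.
Proof.
move=> a Pa na; have [pa _] := Pa.
(* Finds [b] with [Phi (w b) = Phi a]. Injectivity on [V^{p-1,q-1}]: for [b] nonzero in the kernel,
   [Q(w b, w b)] is negative by [Qneg], yet zero or positive by [Qpos]. *)
have [|||b [/in_lowerE lb eb]] := @endo_surj (lowset p q) (Phi \o wedge w) _ _ (Phi a).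
- by move=> b /in_lowerE/lower_pq/Phi_lower/in_lowerE.
- move=> b /in_lowerE lb /= e; apply/eqP; apply: contraT => nb.
  have := Qneg lb nb; have [->|nwb] := eqVneq (w \w b) 0.
    by rewrite /Qform wedge0l wedge0l star0 mulr0 ltxx.
  by have := Qpos (lower_pq lb) e nwb => /lt_trans h /h; rewrite ltxx.
- exact/in_lowerE/Phi_lower.
have [b0|nb] := eqVneq b 0.
  by apply: Qpos => //; rewrite -eb b0 /= wedge0r linear0.
have ph : is_pq p q (a - w \w b) by apply: pqB => //; apply: lower_pq.
have Ph0 : Phi (a - w \w b) = 0 by rewrite linearB -eb /= subrr.
have Qh : 0 <= Qform w Om p q (a - w \w b) (a - w \w b).
  have [->|nh] := eqVneq (a - w \w b) 0; first by rewrite /Qform wedge0l wedge0l star0 mulr0.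
  by rewrite ltW // Qpos.
(* Since [a] is primitive the cross terms vanish, which leaves [0 <= Q(a,a) + Q(w b, w b)]. *)
move: Qh; rewrite QformBl !QformBr Qorth_l // Qorth_r // subr0 sub0r opprK -lerBlDr sub0r.
by apply: lt_le_trans; rewrite oppr_gt0 Qneg.
Qed.

(** If [a] is killed by [Om] it is primitive with [Q(a,a) = 0], so HRR gives [a = 0]. Composing with
    [flip] yields an endomorphism of [V^{p,q}], to which [endo_surj] applies. *)
Lemma hard_lefschetz : HLT Om p q.
Proof.
have inj a : is_pq p q a -> a \w Om = 0 -> a = 0.
  move=> pa e; apply/eqP; apply: contraT => na.
  have Pa : primitive w Om p q a by split=> //; rewrite e wedge0l.
  have := hodge_riemann Pa na; rewrite /Qform -wedgeA -OmC wedgeA.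
  have -> : a \w Om \w fconj a = 0 by rewrite e wedge0l.
  by rewrite star0 mulr0 ltxx.
have pqflip a : is_pq (p + 2) (q + 2) a -> supp (pqset p q) (flip a).
  by apply: supp_flip => K h1 h2; rewrite /pqset; apply/andP; split; apply/eqP; lia.
split=> // b; have -> : (n - q = p + 2)%N by lia. have -> : (n - p = q + 2)%N by lia.
move=> pb; have [|||a [/is_pqE pa ea]] := @endo_surj (pqset p q) (flip \o wedger Om) _ _ (flip b).
- by move=> a /is_pqE pa; apply/pqflip/pq_wedge.
- move=> a /is_pqE pa /= e; apply: inj => //.
  by apply: flip_inj; rewrite -/(wedger Om a) e linear0.
- exact: pqflip.
by exists a; split=> //; apply: flip_inj.
Qed.

(** To make [a - w b] primitive, solve [w b Om w = a Om w]; after [flip], the map of [b] is an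
    endomorphism of [V^{p-1,q-1}], injective by [lower_primitive_eq0]. *)
Lemma lefschetz_decomposition : LD w Om p q.
Proof.
have lowflip a : is_pq p q a -> supp (lowset p q) (flip (a \w Om \w w)).
  move=> pa; apply: supp_flip (pq_wedge (pq_wedge pa Om22) w11) => K h1 h2.
  (* The degree equations read [p = hdeg K + 1] and [q = adeg K + 1], so both are positive. *)
  by rewrite /lowset /pqset; apply/and3P; split; last (apply/andP; split; apply/eqP); lia.
split; last split.
- move=> a pa.
  have [|||b [/in_lowerE lb eb]] :=
      @endo_surj (lowset p q) (flip \o (wedger w \o (wedger Om \o wedge w))) _ _ (flip (a \w Om \w w)).
  + by move=> b /in_lowerE lb; apply/lowflip/lower_pq.
  + move=> b /in_lowerE lb /= e; apply: lower_primitive_eq0 => //; split; first exact: lower_pq.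
    by apply: flip_inj; rewrite linear0 -[RHS]e.
  + exact: lowflip.
  exists b, (a - w \w b); split=> //; split; last by rewrite addrC subrK.
  split; first by apply: pqB => //; apply: lower_pq.
  by rewrite !wedgeBl; move/flip_inj: eb => /= <-; rewrite /wedger subrr.
- by move=> b lb /(lower_primitive_eq0 lb) ->; rewrite wedge0r.
- by move=> b c lb pc; rewrite Qorth_r // Qorth_l.
Qed.

End Main.
End Lefschetz.

(** * Positivity of products of Kähler forms *)

Section Positivity.
Variables (C : numClosedFieldType) (n : nat).
Local Notation form := (cform C n).
Implicit Types (a b c w eta : form) (p q k : nat) (K : {set 'I_(n + n)}).

Definition qsgn p q : C := 'i ^ (p%:Z - q%:Z) * (-1) ^+ ((p + q) * (p + q).-1)./2.

Lemma QformE w Om p q a b : Qform w Om p q a b = qsgn p q * star w (a \w fconj b \w Om).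
Proof. by []. Qed.

Lemma qsgn00 : qsgn 0 0 = 1.
Proof. by rewrite /qsgn subrr expr0z mulr1. Qed.

Lemma signS_half k : (-1) ^+ (k.+1 * k)./2 = (-1) ^+ (k * k.-1)./2 * (-1) ^+ k :> C.
Proof. by rewrite -[X in (-1) ^+ X]/((k.+1 * k.+1.-1)./2) -!bin2 binS bin1 exprD. Qed.

Lemma qsgnSl p q : qsgn p.+1 q = qsgn p q * 'i * (-1) ^+ (p + q).
Proof.
rewrite /qsgn addSn [_.+1.-1]/= signS_half intS -addrA [1 + _]addrC expfzDr ?neq0Ci // expr1z; ring.
Qed.

Lemma qsgnSr p q : qsgn p q.+1 = - (qsgn p q * 'i * (-1) ^+ (p + q)).
Proof.
rewrite /qsgn addnS [_.+1.-1]/= signS_half intS opprD addrCA [-1 + _]addrC expfzDr ?neq0Ci // exprN1 invCi; ring.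
Qed.

(** Passes from a (0,k)-form to its conjugate: exchanging a k-form with its conjugate costs
    [(-1) ^+ k]. *)
Lemma qsgn_conj k : qsgn 0 k * (-1) ^+ k = qsgn k 0.
Proof.
elim: k => [|k IH]; first by rewrite mulr1.
rewrite qsgnSr qsgnSl -IH exprS add0n addn0; ring.
Qed.

Lemma qsgn_norm p q : qsgn p q * (qsgn p q)^* = 1.
Proof.
elim: p => [|p IH]; last first.
  rewrite qsgnSl; move: (qsgn p q) IH => x IH; rewrite !rmorphM /= conjCi rmorph_sign.
  transitivity (x * x^* * - ('i ^+ 2) * ((-1) ^+ (p + q) ^+ 2)); first ring.
  by rewrite IH sqrCi opprK sqrr_sign !mulr1.
elim: q => [|q IH]; first by rewrite qsgn00 conjC1 mulr1.
rewrite qsgnSr; move: (qsgn 0 q) IH => x IH; rewrite rmorphN !rmorphM /= conjCi rmorph_sign.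
transitivity (x * x^* * - ('i ^+ 2) * ((-1) ^+ (0 + q) ^+ 2)); first ring.
by rewrite IH sqrCi opprK sqrr_sign !mulr1.
Qed.

(** The factor makes [top_coef] positive on the volume forms of Kähler forms. *)
Definition top_coef eta : C := (qsgn n 0)^* * eta setT.

Lemma top_coefD a b : top_coef (a + b) = top_coef a + top_coef b.
Proof. by rewrite /top_coef cfD mulrDr. Qed.
Lemma top_coefZ x a : top_coef (x *: a) = x * top_coef a.
Proof. by rewrite /top_coef cfZ mulrCA. Qed.
Lemma top_coef0 : top_coef 0 = 0.
Proof. by rewrite /top_coef cf0 mulr0. Qed.
Lemma top_coef_sum (T : Type) (r : seq T) (P : pred T) (F : T -> form) :
  top_coef (\sum_(t <- r | P t) F t) = \sum_(t <- r | P t) top_coef (F t).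
Proof. by apply: (big_morph _ top_coefD top_coef0). Qed.

(** Strict positivity of an (n-k,n-k)-form, tested on all (k,0)-forms and not only on decomposable
    ones. *)
Definition hermitian_positive k eta :=
  forall a, is_pq k 0 a -> a != 0 -> 0 < top_coef (qsgn k 0 *: (a \w fconj a \w eta)).

Lemma hermitian_ge0 k eta a : hermitian_positive k eta -> is_pq k 0 a ->
  0 <= top_coef (qsgn k 0 *: (a \w fconj a \w eta)).
Proof.
move=> H pa; have [->|na] := eqVneq a 0; last exact/ltW/H.
by rewrite !wedge0l scaler0 top_coef0.
Qed.

Lemma card_holo : #|holo_idx n| = n.
Proof. by have := hdegT n; rewrite /hdeg setTI. Qed.

Lemma holo_deg K : hdeg K = n -> adeg K = 0%N -> K = holo_idx n.
Proof.
move=> hK aK; apply/eqP; rewrite eq_sym eqEcard.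
have sK : holo_idx n \subset K.
  have : K :&: holo_idx n == holo_idx n.
    by rewrite eqEcard subsetIr card_holo -[X in (X <= _)%N]hK leqnn.
  by move/eqP/setIidPr.
by rewrite sK card_hadeg hK aK addn0 card_holo leqnn.
Qed.

(** An (n,0)-form is [x] times the product of all [dz_k]; [top_coef] is normalized to cancel
    [qsgn n 0], and [|x|^2] remains. *)
Lemma hermitian_positive_top : hermitian_positive n (form1 C n).
Proof.
move=> a pa na; rewrite wedge1r top_coefZ /top_coef mulrA qsgn_norm mul1r.
have ea : a = a (holo_idx n) *: bas C (holo_idx n).
  rewrite {1}[a]cform_basis (bigD1 (holo_idx n)) //= big1 ?addr0 // => K nK.
  have [->|/pa[hK aK]] := eqVneq (a K) 0; first by rewrite scale0r.
  by rewrite (holo_deg hK aK) eqxx in nK.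
have aH : adeg (holo_idx n) = 0%N.
  have := card_hadeg (holo_idx n); rewrite /hdeg setIid card_holo; lia.
move: na; rewrite ea; set x := a _ => nx.
have x0 : x != 0 by apply: contraNneq nx => ->; rewrite scale0r.
rewrite fconjZ fconj_bas aH muln0 expr0 scale1r swap_holo wedgeZl wedgeZr !cfZ wedge_bas.
have dHA : [disjoint holo_idx n & anti_idx n].
  by rewrite -setI_eq0; apply/eqP/setP => i; rewrite !inE mem_holo mem_anti; case: ltnP.
have -> : holo_idx n :|: anti_idx n = setT.
  by apply/setP => i; rewrite !inE mem_holo mem_anti; case: ltnP.
have -> : shuffle_sign C (holo_idx n) (anti_idx n) = 1.
  rewrite shuffle_prod big1 // => i; rewrite mem_holo => iH; rewrite big1 // => j; rewrite mem_anti => jA.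
  by rewrite ltnNge (leq_trans (ltnW iH) jA).
rewrite dHA scale1r basE eqxx mulr1 -normCK exprn_gt0 // normr_gt0 //.
Qed.

Lemma wedge_sqr k a xi : homog k a -> homog 1 xi ->
  (a \w xi) \w fconj (a \w xi) = (-1) ^+ k *: (a \w fconj a \w (xi \w fconj xi)).
Proof.
move=> ha hx; have ha' : homog k (fconj a).
  rewrite (suppP ha) fconj_sum; apply: supp_sum => K cK; rewrite fconjZ fconj_bas.
  by do 2!apply: suppZ; apply: supp_bas; rewrite card_hadeg hdeg_swap adeg_swap addnC -card_hadeg.
rewrite fconjM -wedgeA (wedgeA xi) (wedgeC hx ha') mul1n wedgeZl wedgeZr.
by rewrite -!wedgeA.
Qed.

(** Absorbs [(i/2) dw_l dwbar_l] into the square of [a]; the sign of the reordering is the one that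
    turns [qsgn k 0] into [qsgn k.+1 0]. *)
Lemma hermitian_step k a A (l : 'I_n) : is_pq k 0 a ->
  qsgn k 0 *: (a \w fconj a \w kahler_std A l) =
  (2^-1 * qsgn k.+1 0) *: ((a \w dw A l) \w fconj (a \w dw A l)).
Proof.
move=> pa; have ha : homog k a by rewrite -[k]addn0; exact: pq_homog.
have hx : homog 1 (dw A l) := pq_homog (@pq_dw _ _ A l).
rewrite (wedge_sqr ha hx) /kahler_std wedgeZr !scalerA; congr (_ *: _).
rewrite qsgnSl addn0.
transitivity (2^-1 * qsgn k 0 * 'i * ((-1) ^+ k) ^+ 2); last ring.
by rewrite sqrr_sign; ring.
Qed.

(** Take [K] with nonzero coefficient and [dz_i] missing from it: the coefficient of the product at
    [K] with [i] added receives a contribution from [K] only. *)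
Lemma wedge_dz_neq0 a : a != 0 -> (forall K, a K != 0 -> (hdeg K < n)%N) ->
  exists i, a \w dz C i != 0.
Proof.
move=> na aK.
have [K nK] : exists K, a K != 0.
  apply/existsP; apply: contraR na; rewrite negb_exists => /forallP H.
  by apply/eqP/ffunP => K; rewrite cf0; apply/eqP; rewrite -[_ == _]negbK; apply: H.
have [i iK] : exists i : 'I_n, lshift n i \notin K.
  apply/existsP; have := aK K nK; apply: contraTT; rewrite negb_exists => /forallP H.
  rewrite -leqNgt -[X in (X <= _)%N](hdegT n) /hdeg setTI; apply: subset_leq_card.
  by apply/subsetP => _ /imsetP[i _ ->]; rewrite inE imset_f ?andbT //; move: (H i); rewrite negbK.
exists i; apply/eqP => /ffunP/(_ (lshift n i |: K)); rewrite cf0 ffunE.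
rewrite (bigD1 K) ?subsetUr //= big1 ?addr0 => [|L /andP[sL nL]].
  rewrite dzE basE setDUl setDv setU0 (setDidPl _); last by rewrite disjoints1.
  rewrite eqxx mulr1 => /eqP; rewrite mulf_eq0 (negPf nK) orbF.
  by rewrite /shuffle_sign signr_eq0.
rewrite dzE basE; case: eqP => [e|_]; last by rewrite mulr0.
case/negP: nL; rewrite eqEsubset; apply/andP; split; apply/subsetP => j jL.
  move: (subsetP sL j jL); rewrite inE => /orP[|//] ji.
  by move: ji; rewrite -e inE jL.
apply: contraT => njL; have : j \in (lshift n i |: K) :\: L by rewrite !inE njL jL orbT.
by rewrite e inE => /eqP ji; rewrite -ji jL in iK.
Qed.

(** The [dz_i] are combinations of the [dw_l], so not all products with the [dw_l] can vanish. *)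
Lemma wedge_dw_neq0 A a : A \in unitmx -> a != 0 -> (forall K, a K != 0 -> (hdeg K < n)%N) ->
  exists l, a \w dw A l != 0.
Proof.
move=> uA na aK; have [i nai] := wedge_dz_neq0 na aK.
apply/existsP; apply: contraR nai; rewrite negb_exists => /forallP H.
have -> : dz C i = \sum_l invmx A i l *: dw A l.
  by rewrite -dw1 -(mulVmx uA) -change_dw /dw change_sum; apply: eq_bigr => l _; rewrite changeZ change_dz.
rewrite wedge_sumr big1 // => l _; rewrite wedgeZr.
by move: (H l); rewrite negbK => /eqP ->; rewrite scaler0.
Qed.

(** In coordinates adapted to [w], each summand of [w] tests [eta] on [a dw_l]: all terms are
    nonnegative and one is positive. *)
Lemma hermitian_positive_kahler k w eta : (k < n)%N ->
  kahler w -> hermitian_positive k.+1 eta -> hermitian_positive k (w \w eta).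
Proof.
move=> kn [A [uA ->]] H a pa na.
have pl l : is_pq k.+1 0 (a \w dw A l) by rewrite -addn1 -[0%N]addn0; apply/pq_wedge/pq_dw.
rewrite wedgeA wedge_sumr wedge_suml scaler_sumr top_coef_sum.
have e l : top_coef (qsgn k 0 *: (a \w fconj a \w kahler_std A l \w eta)) =
    2^-1 * top_coef (qsgn k.+1 0 *: (a \w dw A l \w fconj (a \w dw A l) \w eta)).
  by rewrite -wedgeZl hermitian_step // wedgeZl -scalerA top_coefZ.
have [|l nl] := wedge_dw_neq0 uA na; first by move=> K /pa[e' _]; rewrite /hdeg e'.
rewrite (bigD1 l) //= e ltr_pwDl ?sumr_ge0 //.
  by rewrite mulr_gt0 ?invr_gt0 ?ltr0n // H.
by move=> j _; rewrite e mulr_ge0 ?invr_ge0 ?ler0n // hermitian_ge0.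
Qed.

Lemma hermitian_positive_wpow w k : kahler w -> (k <= n)%N ->
  hermitian_positive (n - k) (wpow w k).
Proof.
move=> kw; elim: k => [|k IH] kn; first by rewrite subn0; apply: hermitian_positive_top.
by apply: hermitian_positive_kahler => //; [lia|rewrite subnSK //; apply/IH/ltnW].
Qed.

Lemma form1_neq0 : form1 C n != 0.
Proof.
by apply/eqP => /ffunP/(_ set0); rewrite form1E basE cf0 eqxx => /eqP; rewrite oner_eq0.
Qed.

Lemma kahler_volume_gt0 w : kahler w -> 0 < top_coef (wpow w n).
Proof.
move=> kw; have := @hermitian_positive_wpow w n kw (leqnn n); rewrite subnn.
move/(_ (form1 C n)); rewrite fconj1 wedge1l wedge1l qsgn00 scale1r; apply; last exact: form1_neq0.
by rewrite is_pqE form1E; apply: supp_bas; rewrite /pqset /hdeg /adeg !set0I !cards0.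
Qed.

(** The two functionals differ by the positive factor [n! / top_coef (w^n)]; positivity of [star w]
    is thus independent of [w]. *)
Lemma star_gt0 w eta : kahler w -> (0 < star w eta) = (0 < top_coef eta).
Proof.
move=> kw; have v0 := kahler_volume_gt0 kw.
have -> : star w eta = top_coef eta * ((n`!)%:R / top_coef (wpow w n)).
  have u0 : (qsgn n 0)^* != 0.
    by apply/eqP => u0; have := qsgn_norm n 0; rewrite u0 mulr0 => /eqP; rewrite eq_sym oner_eq0.
  rewrite /star /top_coef invfM invrK; move: v0; rewrite lt0r /top_coef mulf_eq0 negb_or => /andP[/andP[_ v0] _].
  by field; rewrite u0 v0.
by rewrite pmulr_lgt0 // divr_gt0 // ltr0n fact_gt0.
Qed.

(** * Negativity of [Q] on [w V^{p-1,q-1}] *)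

Section MixedOmega.
Variables (c : 'I_n -> 'I_n -> C).
Hypothesis c_gt0 : forall r s, 0 < c r s.
Local Notation om := (kahler_std (1%:M : 'M[C]_n)).

Definition mixed : form := 2^-1 *: \sum_r \sum_s c r s *: (om r \w om s).

(** As for a Kähler form, but absorbing two differentials at once; strictness comes from some [r],
    [s] with [a dz_r dz_s] nonzero. *)
Lemma hermitian_positive_mixed k eta : (k.+1 < n)%N ->
  hermitian_positive k.+2 eta -> hermitian_positive k (mixed \w eta).
Proof.
move=> kn H a pa na.
have pl j b l : is_pq j 0 b -> is_pq j.+1 0 (b \w dz C l).
  by move=> pb; rewrite -addn1 -[0%N]addn0; apply/pq_wedge/pq_dz.
have e r s : top_coef (qsgn k 0 *: (a \w fconj a \w (om r \w om s) \w eta)) =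
    4^-1 * top_coef (qsgn k.+2 0 *: (a \w dz C r \w dz C s \w fconj (a \w dz C r \w dz C s) \w eta)).
  rewrite wedgeA -wedgeZl -wedgeZl hermitian_step // dw1 -scalerA !wedgeZl -[qsgn k.+1 0 *: _]wedgeZl hermitian_step ?dw1; last exact: pl.
  rewrite wedgeZl !scalerA mulrA -scalerA top_coefZ; congr (_ * _).
  by rewrite -invfM -natrM.
have -> : top_coef (qsgn k 0 *: (a \w fconj a \w (mixed \w eta))) =
  2^-1 * \sum_r \sum_s c r s * top_coef (qsgn k 0 *: (a \w fconj a \w (om r \w om s) \w eta)).
  rewrite wedgeA /mixed wedgeZr wedgeZl scalerA mulrC -scalerA top_coefZ; congr (_ * _).
  rewrite wedge_sumr wedge_suml scaler_sumr top_coef_sum; apply: eq_bigr => r _.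
  rewrite wedge_sumr wedge_suml scaler_sumr top_coef_sum; apply: eq_bigr => s _.
  by rewrite wedgeZr wedgeZl scalerA mulrC -scalerA top_coefZ.
rewrite mulr_gt0 ?invr_gt0 ?ltr0n //.
have ge0 r s : 0 <= c r s * top_coef (qsgn k 0 *: (a \w fconj a \w (om r \w om s) \w eta)).
  rewrite e; apply: mulr_ge0; first exact: ltW.
  apply: mulr_ge0; first by rewrite invr_ge0 ler0n.
  by apply: hermitian_ge0 => //; apply/pl/pl.
have [|r nr] := wedge_dz_neq0 na; first by move=> K /pa[e' _]; rewrite /hdeg e' ltnW.
have [|s ns] := wedge_dz_neq0 nr; first by move=> K /(pl _ _ r pa)[e' _]; rewrite /hdeg e'.
rewrite (bigD1 r) //= ltr_pwDl ?sumr_ge0 // => [|j _]; last by apply: sumr_ge0.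
rewrite (bigD1 s) //= ltr_pwDl ?sumr_ge0 //.
rewrite e; apply: mulr_gt0 => //; apply: mulr_gt0; first by rewrite invr_gt0 ltr0n.
by apply: H => //; apply/pl/pl.
Qed.

Lemma mixed_pq : is_pq 2 2 mixed.
Proof.
apply: pqZ; apply: pq_sum => r _; apply: pq_sum => s _; apply: pqZ.
by apply: (@pq_wedge _ _ 1 1 1 1); apply: pq_kahler_std.
Qed.

Lemma mixed_real : fconj mixed = mixed.
Proof.
rewrite /mixed fconjZ fmorphV rmorph_nat; congr (_ *: _).
rewrite fconj_sum; apply: eq_bigr => r _; rewrite fconj_sum; apply: eq_bigr => s _.
by rewrite fconjZ fconjM !kahler_std_real conj_Creal // ger0_real // ltW.
Qed.

(** As [min(p,q) <= 1], the form [b] has bidegree (p-1,0) or (0,q-1), so it or its conjugate tests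
    the positivity of [w w Om]. The sign flips because [qsgn k.+1 1 = - qsgn k 0]. *)
Lemma Qform_lower_lt0 w p q b : (p + q + 2 = n)%N -> (p <= 1)%N || (q <= 1)%N ->
  kahler w -> in_lower p q b -> b != 0 -> Qform w mixed p q (w \w b) (w \w b) < 0.
Proof.
move=> pqn pq1 kw lb nb.
have wC x : w \w x = x \w w by apply: (@homog_evenC _ _ 2) => //; apply: (pq_homog (kahler_pq kw)).
(* [w w Om] has bidegree (4,4), which is complementary to the square of a (k,0)-form exactly when
   [k + 4 = n]. *)
have key k a : (k + 4 = n)%N -> is_pq k 0 a -> a != 0 ->
    0 < qsgn k 0 * star w (a \w fconj a \w (w \w (w \w mixed))).
  move=> kn pa na; rewrite -starZ star_gt0 //; suff H : hermitian_positive k (w \w (w \w mixed)) by apply: H.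
  apply: hermitian_positive_kahler; [lia|done|].
  apply: hermitian_positive_kahler; [lia|done|].
  rewrite -(wedge1r mixed); apply: hermitian_positive_mixed; first by lia.
  have -> : k.+4 = n by lia.
  exact: hermitian_positive_top.
have eQ : Qform w mixed p q (w \w b) (w \w b) = qsgn p q * star w (b \w fconj b \w (w \w (w \w mixed))).
  rewrite QformE fconjM kahler_real //; congr (_ * star _ _).
  rewrite -!wedgeA (wC (b \w _)) -!wedgeA; congr (b \w _).
  rewrite (wC (fconj b \w _)) -!wedgeA; congr (_ \w _).
  by rewrite (wC mixed) (wC (mixed \w w)) -wedgeA.
rewrite eQ; move: lb nb; rewrite /in_lower; case: ifP => [_ ->|]; first by rewrite eqxx.
case: p q pqn pq1 {eQ} => [|p] [|q] //= pqn; case: p pqn => [|p] pqn pq1 _ pb nb; last first.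
  case: q pq1 pqn pb => [|//] _ pqn pb.
  rewrite qsgnSr qsgnSl !addn0 -oppr_gt0.
  have := key p.+1 b _ pb nb; have -> : (p.+1 + 4)%N = n by lia.
  move/(_ erefl); congr (0 < _); rewrite -mulNr opprK; congr (_ * _).
  transitivity (- 'i ^+ 2 * ((-1) ^+ p.+1) ^+ 2 * qsgn p.+1 0); first by rewrite sqrCi opprK sqrr_sign !mul1r.
  by rewrite [(-1) ^+ p.+2]exprS; ring.
(* Here [b] has bidegree [(0,q)] and its conjugate is tested. *)
have := key q (fconj b) _ (pq_fconj pb); have -> : (q + 4)%N = n by lia.
move/(_ erefl); rewrite fconjK -oppr_gt0.
have -> : fconj b \w b = (-1) ^+ q *: (b \w fconj b).
  have hb : homog q b by exact: (pq_homog pb).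
  have hb' : homog q (fconj b) by rewrite -[q]addn0; exact: (pq_homog (pq_fconj pb)).
  by rewrite (wedgeC hb' hb) -signr_odd -[in RHS]signr_odd oddM andbb.
rewrite wedgeZl starZ mulrA -qsgn_conj qsgnSr qsgnSl => H.
have /H : fconj b != 0 by apply: contraNneq nb => e; rewrite -(fconjK b) e fconj0.
congr (0 < _); rewrite -mulNr; congr (_ * _).
rewrite opprK add0n add1n exprS.
transitivity (qsgn 0 q * ((-1) ^+ q) ^+ 2); first ring.
transitivity (- 'i ^+ 2 * qsgn 0 q * ((-1) ^+ q) ^+ 2); first by rewrite sqrCi opprK mul1r.
ring.
Qed.

End MixedOmega.
End Positivity.

(** * The inequality on a block *)

Section BlockInequality.
Variables (C : numClosedFieldType) (I : finType).
Variables (b00 b01 b10 b11 : I -> C).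
Hypothesis b00_gt0 : forall i, 0 < b00 i.
Hypothesis b11_gt0 : forall i, 0 < b11 i.
Hypothesis b10E : forall i, b10 i = (b01 i)^*.
Hypothesis det_gt0 : forall i, 0 < b00 i * b11 i - b01 i * b10 i.
Implicit Types (i j l m r s : I) (L : {set I}).

(** The polarized determinant [det(B^i + B^j) - det B^i - det B^j]; on the diagonal it is
    [2 det B^i]. *)
Definition mixdisc i j : C := b00 i * b11 j + b00 j * b11 i - b01 i * b10 j - b01 j * b10 i.

Lemma mixdiscC i j : mixdisc i j = mixdisc j i.
Proof. by rewrite /mixdisc; ring. Qed.

Lemma b00_conj i : (b00 i)^* = b00 i. Proof. exact/conj_Creal/gtr0_real. Qed.
Lemma b11_conj i : (b11 i)^* = b11 i. Proof. exact/conj_Creal/gtr0_real. Qed.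
Lemma b10_conj i : (b10 i)^* = b01 i. Proof. by rewrite b10E conjCK. Qed.

(** Multiplied by [b00 i * b00 j], it is a sum of two positive multiples of determinants and a
    squared modulus. *)
Lemma mixdisc_gt0 i j : 0 < mixdisc i j.
Proof.
have a0 := b00_gt0 i; have a0' := b00_gt0 j.
rewrite -(pmulr_lgt0 _ (mulr_gt0 a0 a0')).
have -> : mixdisc i j * (b00 i * b00 j) =
  b00 j ^+ 2 * (b00 i * b11 i - b01 i * b10 i) + b00 i ^+ 2 * (b00 j * b11 j - b01 j * b10 j)
  + (b00 i * b01 j - b00 j * b01 i) * (b00 i * b01 j - b00 j * b01 i)^*.
  by rewrite rmorphB !rmorphM /= !b00_conj -!b10E /mixdisc; ring.
by rewrite ltr_pwDl ?mul_conjC_ge0 // addr_gt0 // mulr_gt0 // exprn_gt0.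
Qed.

(** The mixed discriminant is a Lorentzian form on Hermitian matrices; at a
    traceless matrix it is minus the squared norm. *)
Lemma mixdisc_lorentz L (z : I -> C) :
  \sum_(i in L) (b00 i + b11 i) * z i = 0 ->
  \sum_(i in L) \sum_(j in L) mixdisc i j * z i * (z j)^* <= 0.
Proof.
move=> tr0.
(* The four values of [H] are the entries of the matrix [sum z_i B^i]. *)
pose H (b : I -> C) := \sum_(i in L) b i * z i.
have Hc (b b' : I -> C) : (forall i, (b i)^* = b' i) -> \sum_(j in L) b' j * (z j)^* = (H b)^*.
  by move=> bb'; rewrite rmorph_sum; apply: eq_bigr => i _; rewrite rmorphM /= bb'.
have -> : \sum_(i in L) \sum_(j in L) mixdisc i j * z i * (z j)^* =
    H b00 * (H b11)^* + H b11 * (H b00)^* - H b01 * (H b01)^* - H b10 * (H b10)^*.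
  rewrite -(Hc b11 b11 b11_conj) -(Hc b00 b00 b00_conj) -(Hc b01 b10) => [|i]; last by rewrite b10E.
  rewrite -(Hc b10 b01 b10_conj) /H !mulr_suml -!sumrN -!big_split /=; apply: eq_bigr => i _.
  rewrite !mulr_sumr -!sumrN -!big_split /=; apply: eq_bigr => j _; rewrite /mixdisc; ring.
(* With trace zero the value becomes [- 2 |H b00|^2 - |H b01|^2 - |H b10|^2]. *)
have -> : H b11 = - H b00.
  by apply/eqP; rewrite -addr_eq0 addrC -big_split /=; rewrite -[X in _ == X]tr0; apply/eqP/eq_bigr => i _; rewrite mulrDl.
rewrite rmorphN mulrN mulNr -!opprD oppr_le0.
by rewrite !addr_ge0 // mul_conjC_ge0.
Qed.

(** Up to normalization, the coefficient of the product of [om_i], [i] in [L], in [om_l om_m Om].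
    For four-element [L] and distinct [l], [m] in it, it is [2 c_rs] with [r], [s] the other two
    indices. *)
Definition blockN L l m : C :=
  \sum_(r in L) \sum_(s in L) mixdisc r s * (uniq [:: l; m; r; s])%:R.

Definition block_pi L l : C := \prod_(j in L :\ l) mixdisc l j.
(** The product of [mixdisc] over the unordered pairs of [L]. *)
Definition block_lambda L : C := sqrtC (\prod_(l in L) block_pi L l).
(** The trace of [B^l] in the rescaled variable [z_l = y_l / block_pi L l]: vanishing of the
    weighted sum of the [y_l] means [tr H = 0]. *)
Definition block_weight L l : C := (b00 l + b11 l) / block_pi L l.

Lemma block_pi_gt0 L l : 0 < block_pi L l.
Proof. by apply: prodr_gt0 => j _; apply: mixdisc_gt0. Qed.

Lemma block_lambda_gt0 L : 0 < block_lambda L.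
Proof. by rewrite sqrtC_gt0; apply: prodr_gt0 => l _; apply: block_pi_gt0. Qed.

Lemma blockN_diag L l : blockN L l l = 0.
Proof.
by rewrite /blockN big1 // => r _; rewrite big1 // => s _; rewrite /= inE eqxx mulr0.
Qed.

(** With [L = {l,m,r,s}], the two factors [block_pi] contain [c_lm] twice and every other pair once
    except [rs], which [blockN] supplies. *)
Lemma blockN_off L l m : #|L| = 4%N -> l \in L -> m \in L -> l != m ->
  blockN L l m * (block_pi L l * block_pi L m) = 2 * block_lambda L * mixdisc l m.
Proof.
move=> L4 lL mL lm.
have mL' : m \in L :\ l by rewrite !inE eq_sym lm.
have : #|L :\ l :\ m| == 2%N.
  by have := cardsD1 m (L :\ l); have := cardsD1 l L; rewrite lL mL' L4; lia.
case/cards2P => r [s [rs eL]].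
have eqL : L = l |: (m |: [set r; s]) by rewrite -eL setD1K // setD1K.
have : r \in L :\ l :\ m by rewrite eL !inE eqxx.
have : s \in L :\ l :\ m by rewrite eL !inE eqxx orbT.
rewrite !inE => /and3P[sm sl sL] /and3P[rm rl rL].
have nr : r \notin [set s] by rewrite inE.
have nm : m \notin [set r; s] by rewrite !inE negb_or !(eq_sym m) rm sm.
have nl : l \notin m |: [set r; s] by rewrite !inE !negb_or lm (eq_sym l r) (eq_sym l s) rl sl.
have sumL (F : I -> C) : \sum_(i in L) F i = F l + (F m + (F r + F s)).
  by rewrite eqL (big_setU1 l nl) (big_setU1 m nm) (big_setU1 r nr) big_set1.
have prodL (F : I -> C) : \prod_(i in L) F i = F l * (F m * (F r * F s)).
  by rewrite eqL (big_setU1 l nl) (big_setU1 m nm) (big_setU1 r nr) big_set1.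
(* The diagonal factor is inserted to expand a product over all of [L], and cancelled afterwards. *)
have piE i : i \in L -> block_pi L i * mixdisc i i = \prod_(j in L) mixdisc i j.
  by move=> iL; rewrite (big_setD1 i iL) mulrC.
have nz i j : mixdisc i j != 0 by rewrite gt_eqF ?mixdisc_gt0.
have pil : block_pi L l = mixdisc l m * mixdisc l r * mixdisc l s.
  by apply: (mulIf (nz l l)); rewrite piE // prodL; ring.
have pim : block_pi L m = mixdisc l m * mixdisc m r * mixdisc m s.
  by apply: (mulIf (nz m m)); rewrite piE // prodL (mixdiscC m l); ring.
have pir : block_pi L r = mixdisc l r * mixdisc m r * mixdisc r s.
  by apply: (mulIf (nz r r)); rewrite piE // prodL (mixdiscC r l) (mixdiscC r m); ring.
have pis : block_pi L s = mixdisc l s * mixdisc m s * mixdisc r s.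
  by apply: (mulIf (nz s s)); rewrite piE // prodL (mixdiscC s l) (mixdiscC s m) (mixdiscC s r); ring.
have -> : block_lambda L = mixdisc l m * mixdisc l r * mixdisc l s * mixdisc m r * mixdisc m s * mixdisc r s.
  (* Each of the six pairs occurs in two of the four [block_pi], so the radicand is a square. *)
  rewrite /block_lambda prodL pil pim pir pis -[RHS]sqrCK; first by congr sqrtC; ring.
  by rewrite !mulr_ge0 // ltW // mixdisc_gt0.
have -> : blockN L l m = 2 * mixdisc r s.
  rewrite /blockN !sumL /= !inE !eqxx (negPf lm) (negPf rs) ?(eq_sym l) ?(eq_sym m) ?(negPf rl) ?(negPf rm) ?(negPf sl) ?(negPf sm) (eq_sym s r) (negPf rs) /=.
  by rewrite ?orbT /= ?(negPf lm) ?[m == l]eq_sym ?(negPf lm) /= (mixdiscC s r); ring.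
by rewrite pil pim; ring.
Qed.

(** After rescaling, the sum is a positive multiple of the full form in [c_lm], nonpositive by
    [mixdisc_lorentz], minus its strictly positive diagonal. *)
Lemma block_lt0 L (y : I -> C) : #|L| = 4%N -> \sum_(l in L) block_weight L l * y l = 0 ->
  (exists2 l, l \in L & y l != 0) ->
  \sum_(l in L) \sum_(m in L) y l * (y m)^* * blockN L l m < 0.
Proof.
move=> L4 w0 [l0 l0L yl0].
pose z l := y l / block_pi L l.
have pi_conj l : (block_pi L l)^* = block_pi L l by apply/conj_Creal/gtr0_real/block_pi_gt0.
have pi_neq0 l : block_pi L l != 0 by rewrite gt_eqF ?block_pi_gt0.
have zc m : (z m)^* = (y m)^* / block_pi L m by rewrite /z rmorphM /= fmorphV /=; congr (_ / _); apply: pi_conj.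
have eT l m : l \in L -> m \in L -> y l * (y m)^* * blockN L l m =
    2 * block_lambda L * (mixdisc l m * z l * (z m)^* - (l == m)%:R * (mixdisc l m * z l * (z m)^*)).
  move=> lL mL; case: (eqVneq l m) => [->|lm]; first by rewrite blockN_diag mul1r subrr !mulr0.
  rewrite mul0r subr0 zc /z.
  have := blockN_off L4 lL mL lm; rewrite -[LHS](mulrC) => e.
  have -> : blockN L l m = 2 * block_lambda L * mixdisc l m / (block_pi L l * block_pi L m).
    by apply: (canRL (mulfK _)); rewrite ?mulf_neq0 // mulrC.
  by field; rewrite !pi_neq0.
rewrite (eq_bigr (fun l => \sum_(m in L) 2 * block_lambda L *
    (mixdisc l m * z l * (z m)^* - (l == m)%:R * (mixdisc l m * z l * (z m)^*)))); last first.
  by move=> l lL; apply: eq_bigr => m mL; apply: eT.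
under eq_bigr do rewrite -mulr_sumr sumrB.
rewrite -mulr_sumr sumrB pmulr_rlt0 ?mulr_gt0 ?ltr0n ?block_lambda_gt0 // subr_lt0.
apply: le_lt_trans (mixdisc_lorentz _) _.
  rewrite -[RHS]w0; apply: eq_bigr => l _; rewrite /z /block_weight; ring.
have d l : l \in L -> \sum_(m in L) (l == m)%:R * (mixdisc l m * z l * (z m)^*) = mixdisc l l * (z l * (z l)^*).
  move=> lL; rewrite (big_setD1 l lL) /= eqxx mul1r big1 ?addr0 ?mulrA // => m.
  by rewrite !inE eq_sym => /andP[/negPf -> _]; rewrite mul0r.
rewrite (eq_bigr _ d) (big_setD1 l0 l0L) /= ltr_pwDl //.
  rewrite mulr_gt0 ?mixdisc_gt0 // mul_conjC_gt0 /z mulf_neq0 ?invr_neq0 //.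
by apply: sumr_ge0 => l _; rewrite mulr_ge0 ?mul_conjC_ge0 // ltW ?mixdisc_gt0.
Qed.

End BlockInequality.

(** * Block decomposition *)

Section Blocks.
Variables (C : numClosedFieldType) (n : nat).
Local Notation form := (cform C n).
Local Notation bas := (bas C).
Local Notation om := (kahler_std (1%:M : 'M[C]_n)).
Implicit Types (a b h : form) (p q : nat) (K U V : {set 'I_(n + n)}) (S T : {set 'I_n}).

Definition dbl S : {set 'I_(n + n)} := [set lshift n i | i in S] :|: [set rshift n i | i in S].

Lemma lr_eqF (i j : 'I_n) : (lshift n i == rshift n j) = false.
Proof. by apply/eqP => /(congr1 val) /= e; have := ltn_ord i; rewrite e ltnNge leq_addr. Qed.

Lemma mem_dbl_l S i : (lshift n i \in dbl S) = (i \in S).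
Proof.
rewrite !inE mem_imset ?orb_idr //; last exact: lshift_inj.
by case/imsetP => j _ /eqP; rewrite lr_eqF.
Qed.
Lemma mem_dbl_r S i : (rshift n i \in dbl S) = (i \in S).
Proof.
rewrite !inE orbC mem_imset ?orb_idr //; last exact: rshift_inj.
by case/imsetP => j _ /eqP; rewrite eq_sym lr_eqF.
Qed.
Definition mem_dbl := (mem_dbl_l, mem_dbl_r).

Lemma lr_ind (P : 'I_(n + n) -> Prop) :
  (forall i, P (lshift n i)) -> (forall i, P (rshift n i)) -> forall x, P x.
Proof. by move=> Pl Pr x; rewrite -[x]splitK; case: (split x). Qed.

Lemma dblU S T : dbl (S :|: T) = dbl S :|: dbl T.
Proof. by apply/setP; elim/lr_ind => i; rewrite in_setU !mem_dbl in_setU. Qed.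

Lemma dbl0 : dbl set0 = set0.
Proof. by apply/setP; elim/lr_ind => i; rewrite !mem_dbl !inE. Qed.

Lemma dblT : dbl setT = setT.
Proof. by apply/setP; elim/lr_ind => i; rewrite !mem_dbl !inE. Qed.

Lemma dbl_inj : injective dbl.
Proof. by move=> S T /setP e; apply/setP => i; have := e (lshift n i); rewrite !mem_dbl. Qed.

Lemma disjoint_dbl S T : [disjoint dbl S & dbl T] = [disjoint S & T].
Proof.
rewrite -!setI_eq0 -[RHS](inj_eq dbl_inj) dbl0; congr (_ == _).
by apply/setP; elim/lr_ind => i; rewrite in_setI !mem_dbl in_setI.
Qed.

Lemma swap_dbl S : @swap_idx n @: dbl S = dbl S.
Proof.
by apply/setP; elim/lr_ind => i; rewrite mem_swap_set ?swap_idxl ?swap_idxr !mem_dbl.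
Qed.

Lemma disjoint_lr S : [disjoint [set lshift n i | i in S] & [set rshift n i | i in S]].
Proof.
rewrite -setI_eq0; apply/eqP/setP => x; rewrite !inE; apply/negP => /andP[/imsetP[i _ ->]].
by case/imsetP => j _ /eqP; rewrite lr_eqF.
Qed.

Lemma prod_dbl S (F : 'I_(n + n) -> C) :
  \prod_(x in dbl S) F x = \prod_(i in S) (F (lshift n i) * F (rshift n i)).
Proof.
transitivity ((\prod_(x in [set lshift n i | i in S]) F x) * (\prod_(x in [set rshift n i | i in S]) F x)).
  by rewrite -bigU ?disjoint_lr //; apply: eq_bigl => x; rewrite !inE.
rewrite (big_imset _ (in2W (@lshift_inj n n))) (big_imset _ (in2W (@rshift_inj n n))).
by rewrite -big_split.
Qed.

(** For [i] in [S] and [j] in [T], the two comparisons within one type give equal signs; of the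
    mixed ones exactly one is an inversion. *)
Lemma shuffle_dbl S T : shuffle_sign C (dbl S) (dbl T) = (-1) ^+ (#|S| * #|T|).
Proof.
rewrite shuffle_prod prod_dbl.
have -> : (-1) ^+ (#|S| * #|T|) = \prod_(i in S) \prod_(j in T) (-1) :> C.
  by under eq_bigr do rewrite prodr_const; rewrite prodr_const -exprM mulnC.
apply: eq_bigr => i _; rewrite !prod_dbl -big_split; apply: eq_bigr => j _ /=.
rewrite -!exprD -signr_odd.
have -> : (n + j < i)%N = false by have := ltn_ord i; lia.
have -> : (j < n + i)%N by have := ltn_ord j; lia.
have -> : (n + j < n + i)%N = (j < i)%N by lia.
by case: (j < i)%N.
Qed.

Lemma card_lr K : #|K| = (#|[set i | lshift n i \in K]| + #|[set i | rshift n i \in K]|)%N.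
Proof.
rewrite -(card_imset _ (@lshift_inj n n)) -(card_imset _ (@rshift_inj n n)).
rewrite -cardsUI (_ : _ :&: _ = set0) ?cards0 ?addn0; last first.
  apply/setP => x; rewrite !inE; apply/negP => /andP[/imsetP[i _ ->]].
  by case/imsetP => j _ /eqP; rewrite lr_eqF.
congr #|pred_of_set _|; apply/setP; elim/lr_ind => i; rewrite !inE.
  rewrite mem_imset ?inE ?orb_idr //; last exact: lshift_inj.
  by case/imsetP => j _ /eqP; rewrite lr_eqF.
rewrite orbC mem_imset ?inE ?orb_idr //; last exact: rshift_inj.
by case/imsetP => j _ /eqP; rewrite eq_sym lr_eqF.
Qed.

Lemma hdeg_dbl S : hdeg (dbl S) = #|S|.
Proof.
rewrite /hdeg (_ : _ :&: _ = [set lshift n i | i in S]) ?card_imset //; first exact: lshift_inj.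
apply/setP => x; rewrite !inE mem_holo; elim/lr_ind: x => i /=; rewrite ?ltn_ord ?ltnNge ?leq_addr /= ?andbT ?andbF.
  by rewrite orb_idr // => /imsetP[j _ /eqP]; rewrite lr_eqF.
by apply/esym/negP => /imsetP[j _ /eqP]; rewrite eq_sym lr_eqF.
Qed.
Lemma adeg_dbl S : adeg (dbl S) = #|S|.
Proof. by rewrite -hdeg_swap swap_dbl hdeg_dbl. Qed.

Lemma sign_halfD j k : (-1) ^+ ((j + k) * (j + k).-1)./2 =
  (-1) ^+ (j * j.-1)./2 * (-1) ^+ (k * k.-1)./2 * (-1) ^+ (j * k) :> C.
Proof.
elim: k => [|k IH]; first by rewrite addn0 muln0 !mulr1.
by rewrite addnS /= !signS_half IH mulnS !exprD; ring.
Qed.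

(** The sign sorts [dz_1 dzbar_1 ... dz_k dzbar_k] into all [dz] before all [dzbar]; [ombas S] is
    thus the product of the [om_i], [i] in [S]. *)
Definition omcoef k : C := ('i / 2) ^+ k * (-1) ^+ (k * k.-1)./2.
Definition ombas S : form := omcoef #|S| *: bas (dbl S).

Lemma omcoef_neq0 k : omcoef k != 0.
Proof. by rewrite mulf_neq0 ?signr_eq0 // expf_neq0 // mulf_neq0 ?neq0Ci ?invr_neq0 ?pnatr_eq0. Qed.

Lemma ombasM S T : ombas S \w ombas T = if [disjoint S & T] then ombas (S :|: T) else 0.
Proof.
rewrite /ombas wedgeZl wedgeZr wedge_bas disjoint_dbl; case: ifP => dST; last by rewrite !scaler0.
rewrite shuffle_dbl dblU cardsU disjoint_setI0 // cards0 subn0 !scalerA; congr (_ *: _).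
rewrite /omcoef sign_halfD exprD; ring.
Qed.

Lemma ombas0 : ombas set0 = form1 C n.
Proof. by rewrite /ombas cards0 dbl0 /omcoef expr0 mul1r expr0 scale1r. Qed.

Lemma om_ombas i : om i = ombas [set i].
Proof.
rewrite /kahler_std dw1 /ombas cards1 /omcoef expr1 mulr1 -bas_rshift dzE wedge_bas.
rewrite disjoints1 inE lr_eqF /= shuffle_prod big_set1 big_set1 /=.
have -> : (n + i < i)%N = false by have := ltn_ord i; lia.
rewrite scale1r; congr (_ *: bas _).
by apply/setP; elim/lr_ind => j; rewrite !mem_dbl !inE ?lr_eqF ?[rshift n j == _]eq_sym ?lr_eqF ?orbF
  ?(inj_eq (@lshift_inj n n)) // eq_sym (inj_eq (@rshift_inj n n)) eq_sym.
Qed.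

Lemma ombas_pq S : is_pq #|S| #|S| (ombas S).
Proof. by apply/pqZ; rewrite is_pqE; apply: supp_bas; rewrite /pqset hdeg_dbl adeg_dbl !eqxx. Qed.

Lemma ombasC S a : ombas S \w a = a \w ombas S.
Proof.
apply: (@homog_evenC _ _ (#|S| + #|S|)); last exact: (pq_homog (@ombas_pq S)).
by rewrite addnn odd_double.
Qed.

Lemma ombas_real S : fconj (ombas S) = ombas S.
Proof.
rewrite /ombas fconjZ fconj_bas swap_dbl hdeg_dbl adeg_dbl scalerA; congr (_ *: _).
rewrite /omcoef rmorphM rmorph_sign rmorphXn /= conj_half_i [(- _) ^+ #|S|]exprNn.
transitivity (('i / 2) ^+ #|S| * (-1) ^+ (#|S| * #|S|.-1)./2 * ((-1) ^+ #|S| * (-1) ^+ (#|S| * #|S|)) : C); first ring.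
have -> : (-1) ^+ #|S| * (-1) ^+ (#|S| * #|S|) = 1 :> C by rewrite -exprD -signr_odd oddD oddM andbb addbb.
by rewrite mulr1.
Qed.

Lemma top_ombas S : top_coef (ombas S) = if S == setT then 2^-1 ^+ n else 0.
Proof.
rewrite top_coefZ /top_coef basE -[in setT == _]dblT (inj_eq dbl_inj) eq_sym.
case: eqP => [->|_]; last by rewrite !mulr0.
rewrite mulr1 cardsT card_ord.
have -> : omcoef n = 2^-1 ^+ n * qsgn C n 0.
  by rewrite /omcoef /qsgn subr0 addn0 exprMn -exprnP; ring.
by rewrite -mulrA qsgn_norm mulr1.
Qed.

Lemma top_chain (s : seq 'I_n) S :
  top_coef (ombas S \w foldr (fun i X => om i \w X) (form1 C n) s) =
  2^-1 ^+ n * [&& uniq s, all (fun i => i \notin S) s & (#|S| + size s == n)%N]%:R.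
Proof.
elim: s S => [|i s IH] S /=.
  rewrite wedge1r top_ombas addn0 eqEcard subsetT /= cardsT card_ord.
  have := max_card S; rewrite card_ord => le; rewrite eqn_leq le /=.
  by case: ifP; rewrite ?mulr1 ?mulr0.
rewrite wedgeA om_ombas ombasM disjoint_sym disjoints1.
case: (boolP (i \in S)) => /= iS; first by rewrite andbF wedge0l top_coef0 mulr0.
rewrite setUC IH cardsU1 iS add1n addSnnS; congr (_ * _); congr (nat_of_bool _)%:R.
have -> : all (fun j => j \notin i |: S) s = (i \notin s) && all (fun j => j \notin S) s.
  elim: s {IH} => //= k s ->; rewrite in_cons !inE !negb_or (eq_sym k).
  by case: (i == k); case: (k \in S); case: (i \in s).
by case: (uniq s); case: (i \notin s).
Qed.

(** Index sets of the monomials [dz_A dzbar_B] with [A], [B] disjoint; [base K] is then the union of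
    [A] and [B]. *)
Definition tame K := [forall i : 'I_n, ~~ ((lshift n i \in K) && (rshift n i \in K))].
Definition base K := [set i : 'I_n | (lshift n i \in K) || (rshift n i \in K)].

Lemma tameP K i : tame K -> ~~ ((lshift n i \in K) && (rshift n i \in K)).
Proof. by move/forallP. Qed.

Lemma card_base K : tame K -> #|base K| = #|K|.
Proof.
move=> tK; rewrite card_lr -cardsUI (_ : _ :&: _ = set0); last first.
  by apply/setP => i; rewrite !inE; apply/negbTE/tameP.
by rewrite cards0 addn0; congr #|pred_of_set _|; apply/setP => i; rewrite !inE.
Qed.

(** Each factor [dz_j] or [dzbar_j] turns into [2 om_j]; the opposite signs of [qsgnSl] and [qsgnSr]
    compensate for the opposite order of [dz_j] and [dzbar_j]. *)
Lemma tame_diag K : tame K ->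
  qsgn C (hdeg K) (adeg K) *: (bas K \w fconj (bas K)) = 2 ^+ #|K| *: ombas (base K).
Proof.
elim/set_below_ind: K => [|i K iK IH] tK.
  rewrite -form1E fconj1 wedge1l /hdeg /adeg !set0I !cards0 qsgn00 expr0 !scale1r.
  by rewrite (_ : base _ = set0) ?ombas0 //; apply/setP => j; rewrite !inE.
have niK := below_notin iK; have diK := below_disjoint niK.
have tK' : tame K.
  by apply/forallP => j; have := tameP j tK; rewrite !inE !negb_and !negb_or => /orP[/andP[_ ->]|/andP[_ ->]]; rewrite ?orbT.
have hK : homog #|K| (bas K) by apply: supp_bas; rewrite /= eqxx.
have hi := @homog_bas1 C n i.
have -> : bas (i |: K) \w fconj (bas (i |: K)) =
    (-1) ^+ #|K| *: (bas K \w fconj (bas K) \w (bas [set i] \w fconj (bas [set i]))).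
  rewrite (bas_below C iK) -(wedge_sqr hK hi) (wedgeC hi hK) mul1n fconjZ wedgeZl wedgeZr scalerA.
  by rewrite rmorph_sign -expr2 sqrr_sign scale1r.
rewrite hdegU // adegU // cardsU1 niK add1n exprS.
(* Common part of the cases [dz_j] and [dzbar_j], which then differ only in the sign of one
   factor. *)
have key j : j \notin base K -> base (i |: K) = j |: base K ->
    qsgn C (hdeg [set i] + hdeg K) (adeg [set i] + adeg K) * (-1) ^+ #|K| *: (bas [set i] \w fconj (bas [set i]))
     = (2 * qsgn C (hdeg K) (adeg K)) *: om j ->
    qsgn C (hdeg [set i] + hdeg K) (adeg [set i] + adeg K) *: ((-1) ^+ #|K| *:
     (bas K \w fconj (bas K) \w (bas [set i] \w fconj (bas [set i])))) = (2 * 2 ^+ #|K|) *: ombas (base (i |: K)).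
  move=> jK -> e; rewrite scalerA -wedgeZr e wedgeZr -scalerA -wedgeZl IH // wedgeZl scalerA om_ombas ombasM.
  by rewrite disjoint_sym disjoints1 jK setUC.
move: niK tK key; rewrite -[ i ]splitK; case: (split i) => j /= niK tK key; apply: (key j).
- have := tameP j tK; rewrite !inE !eqxx /= [rshift _ _ == _]eq_sym lr_eqF /= => /negPf ->.
  by rewrite (negPf niK).
- apply/setP => k; rewrite !inE [rshift _ _ == _]eq_sym lr_eqF /= (inj_eq (@lshift_inj n n)).
  by rewrite -orbA.
- rewrite hdeg_l adeg_l add1n add0n qsgnSl /kahler_std dw1 dzE !scalerA [#|K|]card_hadeg; congr (_ *: _).
  transitivity (qsgn C (hdeg K) (adeg K) * 'i * ((-1) ^+ (hdeg K + adeg K)) ^+ 2); first ring.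
  by rewrite sqrr_sign; field.
- have := tameP j tK; rewrite !inE !eqxx /= lr_eqF /= andbT => /negPf ->.
  by rewrite (negPf niK).
- apply/setP => k; rewrite !inE lr_eqF /= (inj_eq (@rshift_inj n n)).
  by rewrite orbCA.
- have -> : hdeg [set rshift n j] = 0%N by rewrite -swap_idxl -imset_set1 hdeg_swap adeg_l.
  have -> : adeg [set rshift n j] = 1%N by rewrite -swap_idxl -imset_set1 adeg_swap hdeg_l.
  rewrite add1n add0n qsgnSr /kahler_std dw1 bas_rshift fconjK.
  have h1 := @homog_bas1 C n (lshift n j); have h2 := @homog_bas1 C n (rshift n j).
  rewrite -bas_rshift !dzE (wedgeC h2 h1) muln1 expr1 !scalerA [#|K|]card_hadeg; congr (_ *: _).
  transitivity (qsgn C (hdeg K) (adeg K) * 'i * ((-1) ^+ (hdeg K + adeg K)) ^+ 2); first ring.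
  by rewrite sqrr_sign; field.
Qed.

(** A nonzero top coefficient needs [K], the conjugate of [K'] and [dbl S] to partition all indices.
    At [i] outside [S], tameness lets each of [K], [K'] contain only one of [dz_i], [dzbar_i],
    necessarily the same one. *)
Lemma tame_offdiag K K' S : tame K -> tame K' -> K != K' ->
  top_coef (bas K \w fconj (bas K') \w ombas S) = 0.
Proof.
move=> tK tK'; apply: contraNeq; rewrite /top_coef /ombas fconj_bas [bas K \w _]wedgeZr wedgeZl wedgeZr !cfZ wedge_bas.
case: ifP => [d1|_]; last by rewrite wedge0l cf0 !mulr0 eqxx.
rewrite wedgeZl wedge_bas; case: ifP => [d2|_]; last by rewrite !scaler0 cf0 !mulr0 eqxx.
rewrite !cfZ basE; case: (setT =P _) => [e _|_]; last by rewrite !mulr0 eqxx.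
have disj (A B : {set 'I_(n + n)}) x : [disjoint A & B] -> ~~ ((x \in A) && (x \in B)).
  by move=> d; apply/negP => /andP[xA]; rewrite (disjointFr d xA).
have bits i : (lshift n i \in K) = (lshift n i \in K') /\ (rshift n i \in K) = (rshift n i \in K').
  have := disj _ _ (lshift n i) d1; have := disj _ _ (rshift n i) d1.
  have := disj _ _ (lshift n i) d2; have := disj _ _ (rshift n i) d2.
  have : lshift n i \in [set: 'I_(n + n)] := in_setT _.
  have : rshift n i \in [set: 'I_(n + n)] := in_setT _.
  have := tameP i tK; have := tameP i tK'.
  rewrite e ![_ \in _ :|: dbl S]in_setU !mem_dbl ![_ \in K :|: _]in_setU !mem_swap_set !swap_idxl !swap_idxr.
  by case: (lshift n i \in K); case: (rshift n i \in K); case: (lshift n i \in K');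
    case: (rshift n i \in K'); case: (i \in S).
by apply/eqP/setP; elim/lr_ind => i; case: (bits i).
Qed.

(** [dz_A dzbar_B om_S] is a multiple of the basis element at [U], where
    [common U = S] and [tpart U] indexes [dz_A dzbar_B]. *)
Definition common U := [set i : 'I_n | (lshift n i \in U) && (rshift n i \in U)].
Definition tpart U := U :\: dbl (common U).

Lemma tpart_tame U : tame (tpart U).
Proof.
apply/forallP => i; rewrite !in_setD !mem_dbl inE.
by case: (lshift n i \in U); case: (rshift n i \in U).
Qed.

Lemma tpart_disjoint U : [disjoint tpart U & dbl (common U)].
Proof.
rewrite -setI_eq0; apply/eqP/setP => x; rewrite in_setI in_setD in_set0.
by case: (x \in dbl _); rewrite ?andbF.
Qed.

Lemma tpartU U : tpart U :|: dbl (common U) = U.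
Proof.
apply/setP; elim/lr_ind => i; rewrite in_setU in_setD !mem_dbl inE.
  by case: (lshift n i \in U); case: (rshift n i \in U).
by case: (lshift n i \in U); case: (rshift n i \in U).
Qed.

Lemma common_base U i : i \in common U -> i \notin base (tpart U).
Proof. by move=> iU; rewrite inE /tpart !in_setD !mem_dbl iU. Qed.

Lemma commonU K S : tame K -> [disjoint S & base K] -> common (K :|: dbl S) = S.
Proof.
move=> tK dS; apply/setP => i; rewrite inE ![_ \in K :|: _]in_setU !mem_dbl; have := tameP i tK.
have : ~~ ((i \in S) && (i \in base K)) by apply/negP => /andP[iS]; rewrite (disjointFr dS iS).
by rewrite inE; case: (lshift n i \in K); case: (rshift n i \in K); case: (i \in S).
Qed.

Lemma tpartK K S : tame K -> [disjoint S & base K] -> tpart (K :|: dbl S) = K.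
Proof.
move=> tK dS; rewrite /tpart commonU //; apply/setP => x; rewrite in_setD [_ \in K :|: _]in_setU.
elim/lr_ind: x => i; rewrite !mem_dbl;
have : ~~ ((i \in S) && (i \in base K)) by [apply/negP => /andP[iS]; rewrite (disjointFr dS iS)
  | apply/negP => /andP[iS]; rewrite (disjointFr dS iS)].
  by rewrite inE; case: (lshift n i \in K); case: (rshift n i \in K); case: (i \in S).
by rewrite inE; case: (lshift n i \in K); case: (rshift n i \in K); case: (i \in S).
Qed.

Definition tau U : C := omcoef #|common U| * shuffle_sign C (tpart U) (dbl (common U)).

Lemma tau_neq0 U : tau U != 0.
Proof. by rewrite mulf_neq0 ?omcoef_neq0 // /shuffle_sign signr_eq0. Qed.

Lemma tauE U : bas (tpart U) \w ombas (common U) = tau U *: bas U.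
Proof. by rewrite /ombas wedgeZr wedge_bas tpart_disjoint tpartU scalerA. Qed.

(** Coordinates in the basis [dz_A dzbar_B om_S], in which [Q] has no stray shuffle signs. *)
Definition ycoef h U : C := h U / tau U.

Lemma ycoef_expand h : h = \sum_U ycoef h U *: (bas (tpart U) \w ombas (common U)).
Proof.
rewrite {1}[h]cform_basis; apply: eq_bigr => U _.
by rewrite tauE scalerA /ycoef divfK ?tau_neq0.
Qed.

Lemma hdeg_tpart U : hdeg U = (hdeg (tpart U) + #|common U|)%N.
Proof. by rewrite -{1}(tpartU U) hdegU ?tpart_disjoint // hdeg_dbl. Qed.
Lemma adeg_tpart U : adeg U = (adeg (tpart U) + #|common U|)%N.
Proof. by rewrite -{1}(tpartU U) adegU ?tpart_disjoint // adeg_dbl. Qed.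

Lemma qsgn_shift p q s : qsgn C (p + s) (q + s) = (-1) ^+ s * qsgn C p q.
Proof.
elim: s => [|s IH]; first by rewrite !addn0 mul1r.
rewrite !addnS qsgnSl qsgnSr IH addnS !exprS.
transitivity (- (- 'i ^+ 2) * ((-1) ^+ (p + s + (q + s))) ^+ 2 * (-1) ^+ s * qsgn C p q); first ring.
by rewrite sqrCi sqrr_sign; ring.
Qed.

End Blocks.

(** * Positivity of [Q] on the kernel of [Phi] *)

Section PositivePart.
Variables (C : numClosedFieldType) (n : nat).
Local Notation form := (cform C n).
Local Notation bas := (bas C).
Local Notation om := (kahler_std (1%:M : 'M[C]_n)).
Local Notation ombas := (ombas C).
Implicit Types (a b h : form) (K U V : {set 'I_(n + n)}) (S T : {set 'I_n}).
Variables (b00 b01 b10 b11 : 'I_n -> C).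
Hypothesis b00_gt0 : forall i, 0 < b00 i.
Hypothesis b11_gt0 : forall i, 0 < b11 i.
Hypothesis b10E : forall i, b10 i = (b01 i)^*.
Hypothesis det_gt0 : forall i, 0 < b00 i * b11 i - b01 i * b10 i.
Local Notation c := (mixdisc b00 b01 b10 b11).
Local Notation Om := (mixed c).
Let c_gt0 i j : 0 < c i j.
Proof. exact: mixdisc_gt0. Qed.

Lemma chain_mixed (s : seq 'I_n) :
  foldr (fun i X => om i \w X) Om s =
  2^-1 *: \sum_i \sum_j c i j *: foldr (fun i X => om i \w X) (form1 C n) (s ++ [:: i; j]).
Proof.
elim: s => [|l s IH] /=.
  by congr (_ *: _); apply: eq_bigr => i _; apply: eq_bigr => j _; rewrite wedge1r.
rewrite IH wedgeZr wedge_sumr; congr (_ *: _); apply: eq_bigr => i _.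
by rewrite wedge_sumr; apply: eq_bigr => j _; rewrite wedgeZr.
Qed.

Lemma top_chain_mixed (s : seq 'I_n) S :
  top_coef (ombas S \w foldr (fun i X => om i \w X) Om s) =
  2^-1 * 2^-1 ^+ n * \sum_i \sum_j c i j *
    [&& uniq (s ++ [:: i; j]), all (fun i => i \notin S) (s ++ [:: i; j])
      & (#|S| + (size s + 2) == n)%N]%:R.
Proof.
rewrite chain_mixed wedgeZr top_coefZ -mulrA; congr (_ * _).
rewrite wedge_sumr top_coef_sum mulr_sumr; apply: eq_bigr => i _.
rewrite wedge_sumr top_coef_sum mulr_sumr; apply: eq_bigr => j _.
by rewrite wedgeZr top_coefZ top_chain size_cat mulrCA.
Qed.

(** Gram matrix of [Q], up to a positive factor, in the basis dual to [ycoef]. *)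
Definition pairing p q U V : C := top_coef (qsgn C p q *:
  (bas (tpart U) \w fconj (bas (tpart V)) \w (ombas (common U) \w (ombas (common V) \w Om)))).

Lemma pairing_expand p q h :
  top_coef (qsgn C p q *: (h \w fconj h \w Om)) =
  \sum_U \sum_V ycoef h U * (ycoef h V)^* * pairing p q U V.
Proof.
have -> : h \w fconj h \w Om = \sum_U \sum_V (ycoef h U * (ycoef h V)^*) *:
    (bas (tpart U) \w fconj (bas (tpart V)) \w (ombas (common U) \w (ombas (common V) \w Om))).
  rewrite [h in LHS]ycoef_expand fconj_sum wedge_suml wedge_suml; apply: eq_bigr => U _.
  rewrite wedge_sumr wedge_suml; apply: eq_bigr => V _.
  rewrite fconjZ !(wedgeZl (ycoef h U)) (wedgeZr (ycoef h V)^*) (wedgeZl (ycoef h V)^*) scalerA; congr (_ *: _).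
  rewrite fconjM ombas_real -!wedgeA; congr (_ \w _).
  by rewrite wedgeA ombasC -!wedgeA.
rewrite scaler_sumr top_coef_sum; apply: eq_bigr => U _.
rewrite scaler_sumr top_coef_sum; apply: eq_bigr => V _.
by rewrite /pairing scalerA mulrC -scalerA top_coefZ.
Qed.

Lemma pairing_offdiag p q U V : tpart U != tpart V -> pairing p q U V = 0.
Proof.
move=> nUV; rewrite /pairing top_coefZ.
suff -> : top_coef (bas (tpart U) \w fconj (bas (tpart V)) \w (ombas (common U) \w (ombas (common V) \w Om))) = 0.
  by rewrite mulr0.
have -> : Om = 2^-1 *: \sum_i \sum_j c i j *: (ombas [set i] \w ombas [set j]).
  by congr (_ *: _); apply: eq_bigr => i _; apply: eq_bigr => j _; rewrite !om_ombas.
rewrite !(wedgeZr 2^-1) top_coefZ; apply/eqP; rewrite mulf_eq0; apply/orP; right; apply/eqP.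
rewrite !wedge_sumr top_coef_sum big1 // => i _; rewrite !wedge_sumr top_coef_sum big1 // => j _.
rewrite !(wedgeZr (c i j)) top_coefZ.
have z S : top_coef (bas (tpart U) \w fconj (bas (tpart V)) \w ombas S) = 0.
  by apply: tame_offdiag => //; apply: tpart_tame.
rewrite ombasM; case: ifP => _; last by rewrite !wedge0r top_coef0 mulr0.
rewrite ombasM; case: ifP => _; last by rewrite !wedge0r top_coef0 mulr0.
by rewrite ombasM; case: ifP => _; rewrite ?z ?wedge0r ?top_coef0 mulr0.
Qed.

Lemma pairing_diag p q s K U V : tpart U = K -> tpart V = K ->
  p = (hdeg K + s)%N -> q = (adeg K + s)%N ->
  pairing p q U V = (-1) ^+ s * 2 ^+ #|K| *
    top_coef (ombas (base K) \w (ombas (common U) \w (ombas (common V) \w Om))).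
Proof.
move=> eU eV -> ->; rewrite /pairing eU eV qsgn_shift -wedgeZl -scalerA tame_diag; last by rewrite -eU tpart_tame.
by rewrite scalerA wedgeZl top_coefZ.
Qed.

(** Parametrizes the terms with [|S| = 1] in the block of [K] by the single element of [S], which
    lies outside [base K]. *)
Lemma sum_tpart (F : {set 'I_(n + n)} -> C) K : tame K ->
  (forall U, tpart U = K -> #|common U| != 1%N -> F U = 0) ->
  \sum_(U | tpart U == K) F U = \sum_(l in ~: base K) F (K :|: dbl [set l]).
Proof.
move=> tK F0; have dis l : l \in ~: base K -> [disjoint [set l] & base K] by rewrite disjoints1 inE.
transitivity (\sum_(U in [set K :|: dbl [set l] | l in ~: base K]) F U); last first.
  rewrite big_imset //= => l m lL mL /(congr1 (@common n)).
  by rewrite !commonU ?dis // => /set1_inj.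
rewrite (bigID (fun U => #|common U| == 1%N)) /= [X in _ + X]big1 ?addr0; last first.
  by move=> U /andP[/eqP]; apply: F0.
apply: eq_bigl => U; apply/andP/imsetP => [[/eqP eU /cards1P[l el]]|[l lL ->]].
  exists l; last by rewrite -el -eU tpartU.
  by rewrite inE -eU; apply: common_base; rewrite el set11.
by rewrite commonU ?tpartK ?dis // cards1.
Qed.

Section Phi.
Variables (p q : nat).
Hypothesis pqn : (p + q + 2 = n)%N.
Hypothesis pq1 : (p <= 1)%N || (q <= 1)%N.

(** The map [Phi] of the introduction. *)
Definition lower_part h : form := [ffun K : {set 'I_(n + n)} =>
  if lowset p q K && tame K then
    \sum_(l in ~: base K) block_weight b00 b01 b10 b11 (~: base K) l * ycoef h (K :|: dbl [set l])
  else 0].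

Fact lower_part_linear : linear lower_part.
Proof.
move=> x a b; apply/ffunP => K; rewrite cfD cfZ !ffunE; case: ifP => _; last by rewrite mulr0 addr0.
rewrite mulr_sumr -big_split; apply: eq_bigr => l _ /=.
by rewrite /ycoef cfD cfZ; ring.
Qed.
HB.instance Definition _ := GRing.isLinear.Build C form form *:%R lower_part lower_part_linear.

Lemma lower_part_lower h : in_lower p q (lower_part h).
Proof.
by apply/in_lowerE => K; rewrite ffunE; case: ifP => [/andP[]//|_]; rewrite eqxx.
Qed.

Lemma block_sum_gt0 h U0 : is_pq p q h -> lower_part h = 0 -> h U0 != 0 ->
  0 < \sum_(U | tpart U == tpart U0) \sum_(V | tpart V == tpart U0)
      ycoef h U * (ycoef h V)^* * pairing p q U V.
Proof.
move=> ph low0 hU0; set K := tpart U0; set s := #|common U0|.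
have tK : tame K by apply: tpart_tame.
have degU U : tpart U = K -> h U != 0 -> (p = hdeg K + #|common U|)%N /\ (q = adeg K + #|common U|)%N.
  move=> eU hU; have [hh aa] := ph U hU.
  by rewrite -eU -hdeg_tpart -adeg_tpart /hdeg /adeg hh aa.
have [ep eq] := degU U0 erefl hU0; rewrite -/s in ep eq.
have cU U : tpart U = K -> h U != 0 -> #|common U| = s.
  by move=> eU hU; have [e _] := degU U eU hU; move: e; rewrite ep => /addnI.
have y0 U : h U = 0 -> ycoef h U = 0 by rewrite /ycoef => ->; rewrite mul0r.
have yU0 : ycoef h U0 != 0 by rewrite mulf_neq0 ?invr_neq0 ?tau_neq0.
have cK : (#|K| + (s + s + 2) = n)%N by rewrite card_hadeg; lia.
(* [s] is bounded by both [p] and [q], one of which is at most 1. *)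
have s01 : s = 0%N \/ s = 1%N by lia.
have cB := card_base tK.
case: s01 => es.
  have uniqU U : tpart U = K -> U != U0 -> ycoef h U = 0.
    move=> eU nU; apply: y0; apply/eqP; apply: contraNT nU => hU.
    have := cU U eU hU; rewrite es => /eqP; rewrite cards_eq0 => /eqP c0.
    move: es; rewrite /s => /eqP; rewrite cards_eq0 => /eqP c0'.
    by rewrite -(tpartU U) -(tpartU U0) c0 c0' eU.
  rewrite (bigD1 U0) //= [X in _ + X]big1 ?addr0 => [|U /andP[/eqP eU nU]]; last first.
    by apply: big1 => V _; rewrite uniqU // !mul0r.
  rewrite (bigD1 U0) //= [X in _ + X]big1 ?addr0 => [|V /andP[/eqP eV nV]]; last first.
    by rewrite (uniqU V) // rmorph0 mulr0 mul0r.
  apply: mulr_gt0; first by rewrite mul_conjC_gt0.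
  rewrite (pairing_diag (K := K) _ _ ep eq) // es expr0 mul1r.
  have -> : common U0 = set0 by apply/eqP; rewrite -cards_eq0 -/s es.
  rewrite ombas0 !wedge1l; apply: mulr_gt0; first by rewrite exprn_gt0 ?ltr0n.
  rewrite -[Om]/(foldr (fun i X => om i \w X) Om [::]) top_chain_mixed.
  apply: mulr_gt0; first by rewrite mulr_gt0 ?exprn_gt0 ?invr_gt0 ?ltr0n.
  (* Two indices [i], [j] remain free, and the summand [c_ij] makes the nonnegative double sum
     positive. *)
  have : #|~: base K| == 2%N by have := cardsC (base K); rewrite card_ord cB; lia.
  case/cards2P => i [j [ij eij]].
  have iB : i \notin base K by have : i \in ~: base K by [rewrite eij !inE eqxx]; rewrite inE.
  have jB : j \notin base K by have : j \in ~: base K by [rewrite eij !inE eqxx orbT]; rewrite inE.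
  have t0 k l (e : bool) : 0 <= c k l * e%:R by rewrite mulr_ge0 ?ler0n ?ltW.
  rewrite (bigD1 i) //= ltr_pwDl //; last by apply: sumr_ge0 => k _; apply: sumr_ge0 => l _.
  rewrite (bigD1 j) //= ltr_pwDl //; last by apply: sumr_ge0.
  have -> : (#|base K| + (0 + 2) == n)%N by rewrite cB; apply/eqP; lia.
  by rewrite inE ij iB jB mulr1.
set L := ~: base K; have L4 : #|L| = 4%N by have := cardsC (base K); rewrite card_ord cB -/L; lia.
pose y l := ycoef h (K :|: dbl [set l]).
have dis l : l \in L -> [disjoint [set l] & base K] by rewrite disjoints1 inE.
have c1 U : tpart U = K -> #|common U| != 1%N -> ycoef h U = 0.
  by move=> eU nc; apply: y0; apply/eqP; apply: contraNT nc => hU; rewrite (cU U eU hU) es.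
rewrite sum_tpart //; last first.
  by move=> U eU nc; apply: big1 => V _; rewrite c1 // !mul0r.
(* The factors come from [tame_diag] and [top_chain_mixed]; the minus sign below is [(-1) ^+ s] at
   [s = 1]. *)
have kap : 0 < 2 ^+ #|K| * (2^-1 * 2^-1 ^+ n) :> C.
  by rewrite !mulr_gt0 ?exprn_gt0 ?invr_gt0 ?ltr0n.
have -> : \sum_(l in L) \sum_(V | tpart V == K) ycoef h (K :|: dbl [set l]) * (ycoef h V)^* * pairing p q (K :|: dbl [set l]) V =
   (2 ^+ #|K| * (2^-1 * 2^-1 ^+ n)) * - \sum_(l in L) \sum_(m in L) y l * (y m)^* * blockN b00 b01 b10 b11 L l m.
  rewrite mulrN mulr_sumr -sumrN; apply: eq_bigr => l lL; rewrite sum_tpart //; last first.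
    by move=> V eV nc; rewrite (c1 V) // rmorph0 mulr0 mul0r.
  rewrite mulr_sumr -sumrN; apply: eq_bigr => m mL.
  rewrite (pairing_diag (K := K) _ _ ep eq) ?tpartK ?dis // !commonU ?dis // -!om_ombas es expr1.
  rewrite -[om l \w _]/(foldr (fun i X => om i \w X) Om [:: l; m]) top_chain_mixed.
  have -> : \sum_i \sum_j c i j * [&& uniq ([:: l; m] ++ [:: i; j]),
      all (fun i => i \notin base K) ([:: l; m] ++ [:: i; j])
      & (#|base K| + (size [:: l; m] + 2) == n)%N]%:R = blockN b00 b01 b10 b11 L l m.
    rewrite /blockN [RHS]big_mkcond; apply: eq_bigr => i _.
    transitivity (\sum_j if (i \in L) && (j \in L) then c i j * (uniq [:: l; m; i; j])%:R else 0); last first.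
      case: (i \in L); last by rewrite big1.
      by rewrite [RHS]big_mkcond.
    apply: eq_bigr => j _; rewrite /size cB (_ : (#|K| + (2 + 2) == n)%N); last by apply/eqP; lia.
    move: lL mL; rewrite !in_setC /= => -> ->; rewrite andbT !andbT.
    by case: (i \notin base K); case: (j \notin base K); rewrite /= ?andbF ?andbT ?mulr0.
  by rewrite -/(y l) -/(y m); ring.
rewrite pmulr_rgt0 // oppr_gt0; apply: block_lt0 => //.
  (* The weight condition of [block_lt0] is the vanishing of the coefficient of [lower_part h] at
     [K]. *)
  move/ffunP/(_ K): low0; rewrite ffunE cf0 tK andbT.
  have -> : lowset p q K by rewrite /lowset /pqset ep eq es !addn1 /= !eqxx.
  by [].
have /cards1P[l el] : #|common U0| == 1%N by rewrite -/s es.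
exists l; first by rewrite inE; apply: common_base; rewrite el set11.
by rewrite /y -el tpartU.
Qed.

(** Splitting by [tpart] makes [Q(h,h)] a sum over blocks: a block where [h] has a nonzero
    coefficient is positive, the others are zero. *)
Lemma Qform_pos w h : kahler w -> is_pq p q h -> lower_part h = 0 -> h != 0 ->
  0 < Qform w Om p q h h.
Proof.
move=> kw ph low0 nh; rewrite QformE -starZ star_gt0 // pairing_expand.
have [U0 hU0] : exists U, h U != 0.
  apply/existsP; apply: contraR nh; rewrite negb_exists => /forallP H.
  by apply/eqP/ffunP => U; rewrite cf0; apply/eqP; rewrite -[_ == _]negbK; apply: H.
rewrite (partition_big (@tpart n) xpredT) //=.
have inner K : \sum_(U | tpart U == K) \sum_V ycoef h U * (ycoef h V)^* * pairing p q U V =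
    \sum_(U | tpart U == K) \sum_(V | tpart V == K) ycoef h U * (ycoef h V)^* * pairing p q U V.
  apply: eq_bigr => U /eqP eU; rewrite (bigID (fun V => tpart V == K)) /= [X in _ + X]big1 ?addr0 // => V nV.
  by rewrite pairing_offdiag ?mulr0 // eU eq_sym.
rewrite (bigD1 (tpart U0)) //= ltr_pwDl ?inner ?block_sum_gt0 //.
apply: sumr_ge0 => K _; rewrite inner.
case: (pickP (fun U => (tpart U == K) && (h U != 0))) => [U /andP[/eqP <- hU]|none].
  by rewrite ltW // block_sum_gt0.
rewrite big1 // => U eU; apply: big1 => V _.
have := none U; rewrite eU /= => /negbFE/eqP h0.
by rewrite /ycoef h0 !mul0r.
Qed.

End Phi.

Theorem hodge_riemann_mixed w p q : (p + q + 2 = n)%N -> (p <= 1)%N || (q <= 1)%N -> kahler w ->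
  HLT Om p q /\ HRR w Om p q /\ LD w Om p q.
Proof.
move=> pqn pq1 kw.
have w11 := kahler_pq kw; have wr := kahler_real kw.
have O22 := @mixed_pq _ _ c; have Or := mixed_real c_gt0.
have Qn b := @Qform_lower_lt0 _ _ _ c_gt0 w p q b pqn pq1 kw.
have Pl a : is_pq p q a -> in_lower p q (lower_part p q a) by move=> _; apply: lower_part_lower.
have Qp h := @Qform_pos p q pqn pq1 w h kw.
split; [|split].
- exact: (@hard_lefschetz _ _ w Om p q (lower_part p q)).
- exact: (@hodge_riemann _ _ w Om p q (lower_part p q)).
- exact: lefschetz_decomposition.
Qed.

End PositivePart.

(** * Two by two Griffiths positive matrices *)

Section Determinant.
Variables (C : numClosedFieldType) (n : nat).
Local Notation form := (cform C n).
Local Notation om := (kahler_std (1%:M : 'M[C]_n)).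
Local Notation i0 := (ord0 : 'I_2).
Local Notation i1 := (ord_max : 'I_2).

Lemma ord2P (i : 'I_2) : i = i0 \/ i = i1.
Proof. by case: i => [[|[|//]] lt]; [left|right]; apply: val_inj. Qed.

Lemma form_det2 (M : 'I_2 -> 'I_2 -> form) :
  form_det M = M i0 i0 \w M i1 i1 - M i0 i1 \w M i1 i0.
Proof.
have e2 : enum 'I_2 = [:: i0; i1] by apply: (inj_map val_inj); rewrite val_enum_ord.
pose F (s : 'S_2) : form := (-1) ^+ s *: (M i0 (s i0) \w M i1 (s i1)).
have -> : form_det M = \sum_(s : 'S_2) F s.
  by apply: eq_bigr => s _; rewrite e2 /= wedge1r.
have n01 : i0 != i1 by [].
have ne : tperm i0 i1 != 1%g :> 'S_2.
  by apply/eqP => /permP/(_ i0); rewrite tpermL perm1 => /eqP; rewrite eq_sym (negPf n01).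
rewrite (bigD1 1%g) //= (bigD1 (tperm i0 i1)) //= big1 ?addr0.
  by rewrite /F !perm1 tpermL tpermR odd_perm1 odd_tperm n01 expr0 expr1 scale1r scaleN1r.
move=> s /andP[s1 st].
have neq : s i0 != s i1 by rewrite (inj_eq perm_inj).
case: (ord2P (s i0)) (ord2P (s i1)) neq => e0 [] e1; rewrite e0 e1 ?eqxx // => _.
  by case/eqP: s1; apply/permP => i; rewrite perm1; case: (ord2P i) => ->; rewrite ?e0 ?e1.
by case/eqP: st; apply/permP => i; case: (ord2P i) => ->; rewrite ?e0 ?e1 ?tpermL ?tpermR.
Qed.

(** The [om_l] commute, so the coefficients of the determinant can be symmetrized in [r], [s]; this
    gives [mixdisc] and the factor one half. *)
Lemma det_mixed (b : 'I_2 -> 'I_2 -> 'I_n -> C) :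
  form_det (fun i j => \sum_l b i j l *: om l) =
  mixed (mixdisc (b i0 i0) (b i0 i1) (b i1 i0) (b i1 i1)).
Proof.
have omC r s : om r \w om s = om s \w om r by rewrite !om_ombas ombasC.
have prodE (x y : 'I_n -> C) : (\sum_l x l *: om l) \w (\sum_l y l *: om l) =
    \sum_r \sum_s (x r * y s) *: (om r \w om s).
  rewrite wedge_suml; apply: eq_bigr => r _; rewrite wedge_sumr; apply: eq_bigr => s _.
  by rewrite (wedgeZl (x r)) (wedgeZr (y s)) scalerA.
have symE (x : 'I_n -> 'I_n -> C) : \sum_r \sum_s x r s *: (om r \w om s) =
    2^-1 *: \sum_r \sum_s (x r s + x s r) *: (om r \w om s).
  have e : \sum_r \sum_s x s r *: (om r \w om s) = \sum_r \sum_s x r s *: (om r \w om s).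
    by rewrite exchange_big; apply: eq_bigr => r _; apply: eq_bigr => s _; rewrite omC.
  under [in RHS]eq_bigr do under eq_bigr do rewrite scalerDl.
  under [in RHS]eq_bigr do rewrite big_split /=.
  by rewrite big_split /= e -mulr2n -scaler_nat scalerA mulVf ?pnatr_eq0 // scale1r.
rewrite form_det2 !prodE -sumrB.
under eq_bigr do rewrite -sumrB.
under eq_bigr do under eq_bigr do rewrite -scalerBl.
rewrite symE; congr (_ *: _); apply: eq_bigr => r _; apply: eq_bigr => s _.
by rewrite /mixdisc; congr (_ *: _); ring.
Qed.

Lemma diag_coef (x : 'I_n -> C) l : (\sum_k x k *: om k) (dbl [set l]) = x l * ('i / 2).
Proof.
have ob k : om k = omcoef C 1 *: bas C (dbl [set k]) by rewrite om_ombas /ombas cards1.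
rewrite cf_sum (bigD1 l) //= big1 ?addr0 => [|k kl].
  by rewrite cfZ ob cfZ basE eqxx mulr1 /omcoef expr1 mulr1.
rewrite cfZ ob cfZ basE (inj_eq (@dbl_inj n)) (inj_eq set1_inj) eq_sym (negPf kl).
by rewrite !mulr0.
Qed.

Lemma kahler_std_coef (A : 'M[C]_n) m l :
  kahler_std A m (dbl [set l]) = A m l * (A m l)^* * ('i / 2).
Proof.
have dzc j k : (dz C j \w fconj (dz C k)) (dbl [set l]) = ((j == l) && (k == l))%:R.
  rewrite -bas_rshift dzE wedge_bas disjoints1 inE lr_eqF /=.
  rewrite shuffle_prod big_set1 big_set1 /= cfZ basE.
  have -> : (n + k < j)%N = false by have := ltn_ord j; lia.
  rewrite mul1r; congr (nat_of_bool _)%:R; apply/eqP/andP => [e|[/eqP -> /eqP ->]].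
    have := mem_dbl_l [set l] j; have := mem_dbl_r [set l] k.
    by rewrite e !in_setU !in_set1 !eqxx orbT /= => <- <-.
  apply/setP; elim/lr_ind => i; rewrite !mem_dbl in_setU !in_set1.
    by rewrite (inj_eq (@lshift_inj n n)) lr_eqF orbF.
  by rewrite (inj_eq (@rshift_inj n n)) [rshift _ _ == lshift _ _]eq_sym lr_eqF.
have -> : kahler_std A m = ('i / 2) *: \sum_j \sum_k (A m j * (A m k)^*) *: (dz C j \w fconj (dz C k)).
  congr (_ *: _); rewrite /dw fconj_sum wedge_suml; apply: eq_bigr => j _.
  rewrite wedge_sumr; apply: eq_bigr => k _.
  by rewrite fconjZ (wedgeZl (A m j)) (wedgeZr (A m k)^*) scalerA.
rewrite cfZ mulrC cf_sum (bigD1 l) //= [X in _ + X]big1 ?addr0 => [|j jl]; last first.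
  by rewrite cf_sum big1 // => k _; rewrite cfZ dzc (negPf jl) mulr0.
rewrite cf_sum (bigD1 l) //= big1 ?addr0 => [|k kl]; last first.
  by rewrite cfZ dzc (negPf kl) andbF mulr0.
by rewrite cfZ dzc eqxx mulr1.
Qed.

(** Comparing coefficients of [dz_l dzbar_l], [x l] is the squared norm of column [l] of an
    invertible matrix. *)
Lemma kahler_diag_gt0 (x : 'I_n -> C) l : kahler (\sum_k x k *: om k) -> 0 < x l.
Proof.
case=> A [uA e]; have i2 : 'i / 2 != 0 :> C by rewrite mulf_neq0 ?neq0Ci ?invr_neq0 ?pnatr_eq0.
have -> : x l = \sum_m A m l * (A m l)^*.
  apply: (mulIf i2); rewrite -diag_coef e cf_sum mulr_suml.
  by apply: eq_bigr => m _; apply: kahler_std_coef.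
have [m Am] : exists m, A m l != 0.
  apply/existsP; apply: contraT; rewrite negb_exists => /forallP H.
  have := mulVmx uA => /matrixP/(_ l l); rewrite !mxE eqxx big1 => [/eqP|m _].
    by rewrite eq_sym oner_eq0.
  by move: (H m); rewrite negbK => /eqP ->; rewrite mulr0.
rewrite (bigD1 m) //= ltr_pwDl ?mul_conjC_gt0 //.
by apply: sumr_ge0 => j _; apply: mul_conjC_ge0.
Qed.

(** In the diagonalizing coordinates, Griffiths positivity says that each 2x2 matrix [B^l] is
    positive definite; the mixed case then applies to the transported [w], and the result is carried
    back. *)
Theorem griffiths_hodge_riemann (M : 'I_2 -> 'I_2 -> form) (p q : nat) (w : form) :
  griffiths_positive M -> diagonalized_entries M -> kahler w ->
  (p + q + 2 = n)%N -> (p <= 1)%N || (q <= 1)%N ->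
  HLT (form_det M) p q /\ HRR w (form_det M) p q /\ LD w (form_det M) p q.
Proof.
move=> [_ [herm pos]] [A [uA [b Mb]]] kw pqn pq1.
have uA' : invmx A \in unitmx by rewrite unitmx_inv.
pose N i j : form := \sum_l b i j l *: om l.
have MN i j : M i j = change A (N i j).
  rewrite Mb /N change_sum; apply: eq_bigr => l _.
  by rewrite (changeZ A (b i j l)) change_kahler_std mul1mx.
have detE : form_det M = change A (form_det N).
  by rewrite !form_det2 !MN -!changeM -scaleN1r -changeZ -changeD scaleN1r.
have hermN l : b i0 i1 l = (b i1 i0 l)^*.
  have e : N i0 i1 = fconj (N i1 i0).
    by rewrite -(changeVK uA (N _ _)) -MN herm MN -change_fconj changeVK.
  have i2 : 'i / 2 != 0 :> C by rewrite mulf_neq0 ?neq0Ci ?invr_neq0 ?pnatr_eq0.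
  apply: (mulIf i2); rewrite -(diag_coef (b i0 i1)) -(diag_coef (fun l => (b i1 i0 l)^*)).
  have -> : \sum_k (b i1 i0 k)^* *: om k = fconj (N i1 i0).
    by rewrite fconj_sum; apply: eq_bigr => k _; rewrite (fconjZ (b i1 i0 k)) kahler_std_real.
  by rewrite -e.
have posN (t0 t1 : C) l : (t0 != 0) || (t1 != 0) ->
    0 < t0 * t0^* * b i0 i0 l + t0 * t1^* * b i0 i1 l + t1 * t0^* * b i1 i0 l + t1 * t1^* * b i1 i1 l.
  move=> nt; pose th (i : 'I_2) := if i == i0 then t0 else t1.
  have /pos kM : exists i, th i != 0.
    by case/orP: nt => nt; [exists i0 | exists i1].
  pose x l := t0 * t0^* * b i0 i0 l + t0 * t1^* * b i0 i1 l + t1 * t0^* * b i1 i0 l + t1 * t1^* * b i1 i1 l.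
  apply: (@kahler_diag_gt0 x).
  have -> : \sum_k x k *: om k = change (invmx A) (\sum_i \sum_j (th i * (th j)^*) *: M i j).
    rewrite change_sum; under [in RHS]eq_bigr do rewrite change_sum.
    under [in RHS]eq_bigr do under eq_bigr do rewrite changeZ MN changeVK // /N scaler_sumr.
    rewrite !big_ord_recl !big_ord0 !addr0 /=.
    have -> : lift ord0 ord0 = i1 :> 'I_2 by apply: val_inj.
    rewrite /th !eqxx -!big_split; apply: eq_bigr => k _ /=.
    by rewrite !scalerA -!scalerDl /x; congr (_ *: _); ring.
  exact: change_kahler.
have b00 l : 0 < b i0 i0 l.
  have := posN 1 0 l; rewrite oner_neq0 => /(_ isT).
  by rewrite rmorph1 rmorph0 !(mul0r, mulr0, mul1r, addr0).
have b11 l : 0 < b i1 i1 l.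
  have := posN 0 1 l; rewrite oner_neq0 orbT => /(_ isT).
  by rewrite rmorph1 rmorph0 !(mul0r, mulr0, mul1r, add0r).
have b10 l : b i1 i0 l = (b i0 i1 l)^* by rewrite hermN conjCK.
have bdet l : 0 < b i0 i0 l * b i1 i1 l - b i0 i1 l * b i1 i0 l.
  (* At this vector the Hermitian form of [B^l] equals [b i1 i1 l] times its determinant. *)
  have := posN (b i1 i1 l) (- b i0 i1 l) l; rewrite gt_eqF // => /(_ isT).
  rewrite rmorphN /= -b10 (conj_Creal (gtr0_real (b11 l))).
  rewrite (_ : _ + _ = b i1 i1 l * (b i0 i0 l * b i1 i1 l - b i0 i1 l * b i1 i0 l)).
    by rewrite pmulr_rgt0.
  ring.
have := hodge_riemann_mixed b00 b11 b10 bdet pqn pq1 (change_kahler uA' kw).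
rewrite -det_mixed -/N => -[hl [hr ld]].
by rewrite detE -[w](changeKV uA); split; [|split]; [apply: change_HLT|apply: change_HRR|apply: change_LD].
Qed.

(** HLT does not mention a Kähler form but is deduced from HRR, so part (2) must supply one. *)
Lemma kahler_sum_om : kahler (\sum_l om l).
Proof. by exists 1%:M; rewrite unitmx1. Qed.

Theorem theorem2_num (M : 'I_2 -> 'I_2 -> form) :
  (2 <= n)%N ->
  griffiths_positive M -> diagonalized_entries M ->
  let Om := form_det M in
  ((n <= 5)%N -> forall w : form, kahler w ->
     forall p q : nat, (p + q = n - 2)%N ->
       HLT Om p q /\ HRR w Om p q /\ LD w Om p q) /\
  ((6 <= n)%N ->
     HLT Om (n - 2) 0 /\ HLT Om (n - 3) 1 /\ HLT Om 1 (n - 3) /\ HLT Om 0 (n - 2)).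
Proof.
move=> n2 gM dM Om; split=> [n5 w kw p q pq|n6].
  (* For [n <= 5], [p + q <= 3] forces [min(p,q) <= 1]. *)
  by apply: griffiths_hodge_riemann => //; lia.
have H p q : (p + q + 2 = n)%N -> (p <= 1)%N || (q <= 1)%N -> HLT Om p q.
  by move=> pqn pq1; case: (griffiths_hodge_riemann gM dM kahler_sum_om pqn pq1).
by split; [|split; [|split]]; apply: H; lia.
Qed.

End Determinant.

End NumClosed.

Theorem theorem2 (R : realType) (n : nat) (M : 'I_2 -> 'I_2 -> cform R n) :
  (2 <= n)%N ->
  griffiths_positive M -> diagonalized_entries M ->
  let Om := form_det M in
  ((n <= 5)%N -> forall w : cform R n, kahler w ->
     forall p q : nat, (p + q = n - 2)%N ->
       HLT Om p q /\ HRR w Om p q /\ LD w Om p q) /\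
  ((6 <= n)%N ->
     HLT Om (n - 2) 0 /\ HLT Om (n - 3) 1 /\ HLT Om 1 (n - 3) /\ HLT Om 0 (n - 2)).
Proof. exact: (@NumClosed.theorem2_num R[i] n M). Qed.
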